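(* Let $p$ be a prime, let $V$ be a left vector space over $\mathbb{Q}_p$ of finite dimension $n>0$, and let $N,N'$ be two norms on $V$. Let a $\mathbb{Q}_p$-basis $u_1,\ldots,u_n$ of $V$ be given. Then there is a deterministic algorithm which terminates within finitely many steps and finds a $\mathbb{Q}_p$-basis $v_1,\ldots,v_n$ of $V$ which is $N$-orthogonal and is also $N'$-orthogonal, provided that the norms $N(v),N'(v)$ of any vector $v\in V$ can be computed efficiently.
   Context: A norm on a $\mathbb{Q}_p$-vector space $V$ is a function $N:V\to\mathbb{R}$ such that (i) $N(v)\ge 0$ for all $v\in V$, with $N(v)=0$ if and only if $v=0$; (ii) $N(xv)=|x|_p\cdot N(v)$ for all $x\in\mathbb{Q}_p$, $v\in V$; (iii) $N(v+w)\le\max(N(v),N(w))$ for all $v,w\in V$. Here $|\cdot|_p$ is the $p$-adic absolute value. For a norm $N$, a basis $\alpha_1,\ldots,\alpha_n$ of $V$ is called an $N$-orthogonal basis of $V$ over $\mathbb{Q}_p$ if, with $V_i=\mathbb{Q}_p\alpha_i$, $V$ is the direct sum of $V_1,\ldots,V_n$ and $N\left(\sum_{i=1}^n v_i\right)=\max_{1\le i\le n}N(v_i)$ for all $v_i\in V_i$, $i=1,\ldots,n$. Computational convention: the algorithm is given the basis $u_1,\ldots,u_n$ and represents vectors by coordinates with respect to it. The hypothesis that $N(v),N'(v)$ can be computed efficiently means that the algorithm may call procedures which, for any vector $v\in V$ it has constructed, return $N(v)$ and $N'(v)$. Arithmetic in $\mathbb{Q}_p$ and in $\mathbb{R}$ and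 comparison of real numbers are treated as exact single steps. *)

(* Defs.v *)
From HB Require Import structures.
From mathcomp Require Import all_boot all_order all_algebra.
From mathcomp Require Import ring_quotient ring.
From mathcomp Require Import all_classical all_reals all_analysis.

Set Implicit Arguments.
Unset Strict Implicit.
Unset Printing Implicit Defensive.
Import Order.TTheory GRing.Theory Num.Theory numFieldNormedType.Exports.
Local Open Scope ring_scope.

Definition rat_padic_abs (p : nat) (x : rat) : rat :=
  if x == 0 then 0
  else p%:R ^+ logn p `|denq x|%N / p%:R ^+ logn p `|numq x|%N.

Section RatPadicAbs.
Variables (p : nat) (hp : prime p).
Local Notation abs := (rat_padic_abs p).

Let pR_gt0 : 0 < p%:R :> rat.
Proof. by rewrite ltr0n prime_gt0. Qed.

Let pX_gt0 k : 0 < p%:R ^+ k :> rat.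
Proof. exact: exprn_gt0. Qed.

Let pX_neq0 k : p%:R ^+ k != 0 :> rat.
Proof. by rewrite gt_eqF. Qed.

Lemma rat_padic_abs0 : abs 0 = 0.
Proof. by rewrite /rat_padic_abs eqxx. Qed.

Lemma rat_padic_abs_frac (a b : int) : a != 0 -> b != 0 ->
  abs (a%:~R / b%:~R) = p%:R ^+ logn p `|b|%N / p%:R ^+ logn p `|a|%N.
Proof.
move=> a0 b0; set x := a%:~R / b%:~R.
have x0 : x != 0 by rewrite mulf_neq0 ?invr_eq0 ?intr_eq0.
rewrite /rat_padic_abs (negbTE x0).
have E : numq x * b = a * denq x.
  apply: (@intr_inj rat); rewrite !rmorphM /=.
  have := divq_num_den x; rewrite {2}/x => /eqP.
  by rewrite eqr_div ?intr_eq0 ?denq_neq0 // => /eqP.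
have /(congr1 (fun z : int => logn p `|z|%N)) := E.
have nx0 : numq x != 0 by rewrite numq_eq0.
rewrite !abszM !lognM ?absz_gt0 ?denq_neq0 // => El.
apply/eqP; rewrite eqr_div // -!exprD [X in _ == p%:R ^+ X]addnC El.
by rewrite addnC.
Qed.

Lemma rat_padic_abs_gt0 x : (0 < abs x) = (x != 0).
Proof.
by rewrite /rat_padic_abs; case: eqP => //= _; rewrite divr_gt0.
Qed.

Lemma rat_padic_abs_ge0 x : 0 <= abs x.
Proof. by rewrite /rat_padic_abs; case: eqP => //= _; rewrite divr_ge0 // ltW. Qed.

Lemma rat_padic_abs_eq0 x : (abs x == 0) = (x == 0).
Proof.
apply/idP/idP => [/eqP h|/eqP ->]; last by rewrite rat_padic_abs0.
by apply: contraT; rewrite -rat_padic_abs_gt0 h ltxx.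
Qed.

Lemma rat_padic_absM x y : abs (x * y) = abs x * abs y.
Proof.
have [->|x0] := eqVneq x 0; first by rewrite mul0r rat_padic_abs0 mul0r.
have [->|y0] := eqVneq y 0; first by rewrite mulr0 rat_padic_abs0 mulr0.
have -> : x * y = (numq x * numq y)%:~R / (denq x * denq y)%:~R.
  by rewrite -{1}(divq_num_den x) -{1}(divq_num_den y) mulf_div !rmorphM.
rewrite rat_padic_abs_frac ?mulf_neq0 ?numq_eq0 ?denq_neq0 //.
rewrite /rat_padic_abs (negbTE x0) (negbTE y0) mulf_div -!exprD.
by rewrite !abszM !lognM ?absz_gt0 ?numq_eq0 ?denq_neq0.
Qed.

Lemma rat_padic_absN x : abs (- x) = abs x.
Proof. by rewrite /rat_padic_abs oppr_eq0 denqN numqN abszN. Qed.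

Lemma rat_padic_abs1 : abs 1 = 1.
Proof. by rewrite /rat_padic_abs /= logn1 expr0 divr1. Qed.

Lemma rat_padic_absV x : abs x^-1 = (abs x)^-1.
Proof.
have [->|x0] := eqVneq x 0; first by rewrite invr0 rat_padic_abs0 ?invr0.
apply: (@mulIf _ (abs x)); first by rewrite rat_padic_abs_eq0.
by rewrite -rat_padic_absM !mulVf ?rat_padic_abs_eq0 // rat_padic_abs1.
Qed.

Lemma rat_padic_absD x y : abs (x + y) <= Num.max (abs x) (abs y).
Proof.
have [->|x0] := eqVneq x 0; first by rewrite add0r le_max lexx orbT.
have [->|y0] := eqVneq y 0; first by rewrite addr0 le_max lexx.
have [->|xy0] := eqVneq (x + y) 0.
  by rewrite rat_padic_abs0 le_max rat_padic_abs_ge0.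
pose d := denq x * denq y; pose a := numq x * denq y; pose b := numq y * denq x.
have d0 : d != 0 by rewrite mulf_neq0 ?denq_neq0.
have dr0 : d%:~R != 0 :> rat by rewrite intr_eq0.
have rd (z : rat) : (denq z)%:~R != 0 :> rat by rewrite intr_eq0 denq_neq0.
have Ex : x = a%:~R / d%:~R.
  by rewrite !rmorphM /= -mulf_div divff // mulr1 divq_num_den.
have Ey : y = b%:~R / d%:~R.
  by rewrite /d [denq x * _]mulrC !rmorphM /= -mulf_div divff // mulr1 divq_num_den.
have Exy : x + y = (a + b)%:~R / d%:~R by rewrite Ex Ey rmorphD -mulrDl.
have a0 : a != 0 by rewrite mulf_neq0 ?numq_eq0 ?denq_neq0.
have b0 : b != 0 by rewrite mulf_neq0 ?numq_eq0 ?denq_neq0.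
have ab0 : a + b != 0.
  by apply: contraNneq xy0 => h; rewrite Exy h mul0r.
rewrite Exy Ex Ey !rat_padic_abs_frac //.
wlog le_ab : a b a0 b0 ab0 {Ex Ey Exy} / (logn p `|a|%N <= logn p `|b|%N)%N.
  move=> H; case: (leqP (logn p `|a|%N) (logn p `|b|%N)) => h; first exact: H.
  by rewrite addrC maxC; apply: H; rewrite // 1?addrC // ltnW.
rewrite le_max ler_pM2l // lef_pV2 ?posrE //; apply/orP; left.
rewrite ler_weXn2l ?ler1n ?prime_gt0 //.
rewrite -pfactor_dvdn ?absz_gt0 //.
have dv (z : int) : z != 0 -> (logn p `|a|%N <= logn p `|z|%N)%N ->
    ((p ^ logn p `|a|%N)%N%:Z %| z)%Z.
  by move=> z0 h; rewrite dvdzE /= pfactor_dvdn ?absz_gt0.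
have := rpredD (dv a a0 (leqnn _)) (dv b b0 le_ab).
by rewrite dvdzE.
Qed.

Lemma rat_padic_absB x y : abs (x - y) <= Num.max (abs x) (abs y).
Proof. by rewrite -(rat_padic_absN y) rat_padic_absD. Qed.

Lemma rat_padic_abs_lt_eq x y : abs (x - y) < abs y -> abs x = abs y.
Proof.
move=> h; apply/eqP; rewrite eq_le; apply/andP; split.
  have := rat_padic_absD (x - y) y; rewrite subrK => /le_trans; apply.
  by rewrite ge_max lexx ltW.
rewrite leNgt; apply/negP => h'.
have := rat_padic_absB x (x - y); rewrite opprB addrCA subrr addr0.
by rewrite le_max leNgt h' /= leNgt h.
Qed.

End RatPadicAbs.

Definition padic_cauchy (p : nat) (hp : prime p) : {pred (nat -> rat)} :=
  fun x => `[< forall e : rat, 0 < e -> exists k, forall m n,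
    (k <= m)%N -> (k <= n)%N -> rat_padic_abs p (x m - x n) < e >].

Section CauchyClosed.
Variables (p : nat) (hp : prime p).
Local Notation abs := (rat_padic_abs p).

Lemma padic_cauchy_bounded (x : nat -> rat) : x \in padic_cauchy hp ->
  exists2 b : rat, 0 < b & forall n, abs (x n) <= b.
Proof.
move=> /asboolP /(_ 1 ltr01) [k xk].
pose b := 1 + \sum_(i < k.+1) abs (x i).
have le_b i : (i <= k)%N -> abs (x i) + 1 <= b.
  move=> ik; rewrite addrC lerD2l (bigD1 (Ordinal (ik : (i < k.+1)%N))) //=.
  by rewrite lerDl sumr_ge0 // => j _; exact: rat_padic_abs_ge0.
exists b.
  by rewrite ltr_pwDl // sumr_ge0 // => j _; exact: rat_padic_abs_ge0.
move=> n; case: (leqP n k) => nk.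
  by apply: le_trans (le_b n nk); rewrite lerDl.
rewrite -[x n](subrK (x k)).
apply: le_trans (rat_padic_absD hp _ _) _; rewrite ge_max; apply/andP; split.
  apply: le_trans (ltW (xk n k (ltnW nk) (leqnn k))) _.
  by apply: le_trans (le_b k (leqnn k)); rewrite lerDr rat_padic_abs_ge0.
by apply: le_trans (le_b k (leqnn k)); rewrite lerDl.
Qed.

Lemma padic_cauchy_subring : subring_closed (padic_cauchy hp).
Proof.
split=> [|x y xC yC|x y xC yC]; apply/asboolP => e e0.
- by exists 0%N => m n _ _; rewrite subrr rat_padic_abs0.
- have [k1 h1] := asboolP _ xC e e0; have [k2 h2] := asboolP _ yC e e0.
  exists (maxn k1 k2) => m n; rewrite !geq_max => /andP[m1 m2] /andP[n1 n2].
  have -> : (x - y) m - (x - y) n = (x m - x n) - (y m - y n).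
    by rewrite !fctE; ring.
  apply: le_lt_trans (rat_padic_absB hp _ _) _.
  by rewrite gt_max h1 ?h2.
- have [b b0 xb] := padic_cauchy_bounded xC.
  have [c c0 yc] := padic_cauchy_bounded yC.
  have [k1 h1] := asboolP _ xC (e / c) (divr_gt0 e0 c0).
  have [k2 h2] := asboolP _ yC (e / b) (divr_gt0 e0 b0).
  exists (maxn k1 k2) => m n; rewrite !geq_max => /andP[m1 m2] /andP[n1 n2].
  have -> : (x * y) m - (x * y) n = (x m - x n) * y m + x n * (y m - y n).
    by rewrite !fctE; ring.
  apply: le_lt_trans (rat_padic_absD hp _ _) _.
  rewrite gt_max !rat_padic_absM //; apply/andP; split.
    apply: le_lt_trans (ler_wpM2l (rat_padic_abs_ge0 p (x m - x n)) (yc m)) _.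
    by rewrite -ltr_pdivlMr // h1.
  apply: le_lt_trans (ler_wpM2r (rat_padic_abs_ge0 p (y m - y n)) (xb n)) _.
  by rewrite mulrC -ltr_pdivlMr // h2.
Qed.

HB.instance Definition _ :=
  GRing.isSubringClosed.Build _ (padic_cauchy hp) padic_cauchy_subring.

End CauchyClosed.

Record padic_cauchy_seq (p : nat) (hp : prime p) : Type := PadicCauchySeq {
  padic_seq :> nat -> rat;
  padic_seqP : padic_cauchy hp padic_seq
}.

HB.instance Definition _ p hp := [isSub for @padic_seq p hp].
HB.instance Definition _ p hp := [Choice of @padic_cauchy_seq p hp by <:].
HB.instance Definition _ p hp :=
  [SubChoice_isSubComNzRing of @padic_cauchy_seq p hp by <:].

Definition padic_null (p : nat) (hp : prime p) : {pred padic_cauchy_seq hp} :=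
  fun x => `[< forall e : rat, 0 < e -> exists k, forall n,
    (k <= n)%N -> rat_padic_abs p (x n) < e >].

Section NullIdeal.
Variables (p : nat) (hp : prime p).
Local Notation abs := (rat_padic_abs p).
Implicit Types x y : padic_cauchy_seq hp.

Lemma padic_null_ideal : idealr_closed (@padic_null p hp).
Proof.
split.
- by apply/asboolP => e e0; exists 0%N => n _; rewrite rat_padic_abs0.
- apply/negP => /asboolP /(_ 1 ltr01) [k] /(_ k (leqnn k)).
  by rewrite rat_padic_abs1 ltxx.
- move=> a x y xN yN; apply/asboolP => e e0.
  have [b b0 ab] := padic_cauchy_bounded (padic_seqP a).
  have [k1 h1] := asboolP _ xN (e / b) (divr_gt0 e0 b0).
  have [k2 h2] := asboolP _ yN e e0.
  exists (maxn k1 k2) => n; rewrite !geq_max => /andP[n1 n2].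
  apply: le_lt_trans (rat_padic_absD hp _ _) _.
  rewrite gt_max (h2 n n2) andbT rat_padic_absM //.
  apply: le_lt_trans (ler_wpM2r (rat_padic_abs_ge0 p (x n)) (ab n)) _.
  by rewrite mulrC -ltr_pdivlMr // h1.
Qed.

HB.instance Definition _ := isIdealr.Build _ (@padic_null p hp) padic_null_ideal.

Lemma padic_abs_stationary x : x \notin @padic_null p hp ->
  exists2 c : rat, 0 < c & exists k, forall n, (k <= n)%N -> abs (x n) = c.
Proof.
move=> xN; have [e e0 he] : exists2 e : rat, 0 < e &
    forall k, exists2 n, (k <= n)%N & e <= abs (x n).
  apply: contrapT => H; move/negP: xN; apply; apply/asboolP => e e0.
  apply: contrapT => H'; apply: H; exists e => // k.
  apply: contrapT => H''; apply: H'; exists k => n kn.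
  by rewrite ltNge; apply/negP => h; apply: H''; exists n.
have [k hk] := asboolP _ (padic_seqP x) e e0; have [m km hm] := he k.
exists (abs (x m)); first exact: lt_le_trans hm.
exists k => n kn; apply: rat_padic_abs_lt_eq => //.
by apply: lt_le_trans hm; apply: hk.
Qed.

Lemma padic_cauchy_inv x : x \notin @padic_null p hp ->
  padic_cauchy hp (fun n => (x n)^-1).
Proof.
move=> /padic_abs_stationary [c c0 [k hk]]; apply/asboolP => e e0.
have [l hl] := asboolP _ (padic_seqP x) (e * (c * c)) (mulr_gt0 e0 (mulr_gt0 c0 c0)).
exists (maxn k l) => m n; rewrite !geq_max => /andP[m1 m2] /andP[n1 n2].
have nz i : (k <= i)%N -> x i != 0.
  by move=> ki; rewrite -(rat_padic_abs_gt0 hp) hk.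
have -> : (x m)^-1 - (x n)^-1 = (x n - x m) / (x m * x n).
  by rewrite mulrBl invfM mulrCA mulfV ?nz // mulr1 mulrA mulfV ?nz // mul1r.
by rewrite rat_padic_absM // rat_padic_absV // rat_padic_absM // !hk //
  ltr_pdivrMr ?mulr_gt0 // hl.
Qed.

End NullIdeal.

(* The completion of the rationals for the p-adic absolute value. *)
Definition Qp (p : nat) (hp : prime p) : Type := {ideal_quot @padic_null p hp}.

HB.instance Definition _ p hp := GRing.ComNzRing.on (@Qp p hp).
HB.instance Definition _ p hp := EqQuotient.on (@Qp p hp).

Definition Qp_class (p : nat) (hp : prime p) (a : padic_cauchy_seq hp) : Qp hp :=
  \pi_({ideal_quot @padic_null p hp})%qT a.

Fact Qp_class_zmod_morphism p hp : zmod_morphism (@Qp_class p hp).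
Proof. by move=> a b; exact: (rmorphB \pi_({ideal_quot @padic_null p hp})%qT). Qed.

Fact Qp_class_monoid_morphism p hp : monoid_morphism (@Qp_class p hp).
Proof.
split=> [|a b]; first exact: (rmorph1 \pi_({ideal_quot @padic_null p hp})%qT).
exact: (rmorphM \pi_({ideal_quot @padic_null p hp})%qT).
Qed.

HB.instance Definition _ p hp := GRing.isZmodMorphism.Build _ _
  (@Qp_class p hp) (@Qp_class_zmod_morphism p hp).
HB.instance Definition _ p hp := GRing.isMonoidMorphism.Build _ _
  (@Qp_class p hp) (@Qp_class_monoid_morphism p hp).

Definition Qp_repr (p : nat) (hp : prime p) (x : Qp hp) : padic_cauchy_seq hp :=
  repr (x : {ideal_quot @padic_null p hp}).

Section QpField.
Variables (p : nat) (hp : prime p).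
Implicit Types x : Qp hp.

Lemma Qp_reprK x : Qp_class (Qp_repr x) = x.
Proof. exact: reprK. Qed.

Lemma Qp_class_eq0 (a : padic_cauchy_seq hp) :
  (Qp_class a == 0) = (a \in @padic_null p hp).
Proof.
by rewrite -(rmorph0 (@Qp_class p hp)) -[_ == _]Quotient.idealrBE subr0.
Qed.

Lemma Qp_repr_null x : (Qp_repr x \in @padic_null p hp) = (x == 0).
Proof. by rewrite -Qp_class_eq0 Qp_reprK. Qed.

Definition Qp_inv x : Qp hp :=
  if pselect (Qp_repr x \notin @padic_null p hp) is left h
  then Qp_class (PadicCauchySeq (padic_cauchy_inv h)) else 0.

Lemma Qp_inv0 : Qp_inv 0 = 0.
Proof.
rewrite /Qp_inv; case: pselect => // h.
by exfalso; move: h; rewrite Qp_repr_null eqxx.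
Qed.

Lemma Qp_mulVf x : x != 0 -> Qp_inv x * x = 1.
Proof.
rewrite -Qp_repr_null /Qp_inv => x0; case: pselect => // h.
rewrite -[X in _ * X]Qp_reprK -rmorphM; apply/eqP.
rewrite -subr_eq0 -(rmorph1 (@Qp_class p hp)) -rmorphB Qp_class_eq0.
apply/asboolP => e e0.
have [c c0 [k hk]] := padic_abs_stationary h.
exists k => n kn.
have nz : Qp_repr x n != 0 by rewrite -(rat_padic_abs_gt0 hp) hk.
rewrite -[padic_seq _ n]/((Qp_repr x n)^-1 * Qp_repr x n - 1).
by rewrite mulVf // subrr rat_padic_abs0.
Qed.

HB.instance Definition _ :=
  GRing.ComNzRing_isField.Build (Qp hp) Qp_mulVf Qp_inv0.

End QpField.

Fact padic_cauchy_cst (p : nat) (hp : prime p) (q : rat) :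
  padic_cauchy hp (fun=> q).
Proof.
by apply/asboolP => e e0; exists 0%N => m n _ _; rewrite subrr rat_padic_abs0.
Qed.

Definition Qp_cst (p : nat) (hp : prime p) (q : rat) : Qp hp :=
  Qp_class (PadicCauchySeq (padic_cauchy_cst hp q)).

Fact Qp_cst_zmod_morphism p hp : zmod_morphism (@Qp_cst p hp).
Proof. by move=> a b; rewrite -rmorphB; congr Qp_class; apply/val_inj. Qed.

Fact Qp_cst_monoid_morphism p hp : monoid_morphism (@Qp_cst p hp).
Proof.
split=> [|a b]; first by rewrite -(rmorph1 (@Qp_class p hp)); congr Qp_class; apply/val_inj.
by rewrite -rmorphM; congr Qp_class; apply/val_inj.
Qed.

HB.instance Definition _ p hp :=
  GRing.isZmodMorphism.Build _ _ (@Qp_cst p hp) (@Qp_cst_zmod_morphism p hp).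
HB.instance Definition _ p hp :=
  GRing.isMonoidMorphism.Build _ _ (@Qp_cst p hp) (@Qp_cst_monoid_morphism p hp).

(* The absolute values of a Cauchy sequence converge: either they tend to 0 or
   they are eventually constant. *)
Definition Qp_abs (R : realType) (p : nat) (hp : prime p) (x : Qp hp) : R :=
  limn (fun n => ratr (rat_padic_abs p (Qp_repr x n)) : R).

Section QpAbs.
Local Open Scope classical_set_scope.
Variables (R : realType) (p : nat) (hp : prime p).
Implicit Types (a b : padic_cauchy_seq hp) (x y : Qp hp).
Local Notation absR a := (fun n => ratr (rat_padic_abs p (padic_seq a n)) : R).
Local Notation abs := (@Qp_abs R p hp).

Lemma padic_null_cvg a : a \in @padic_null p hp -> absR a @ \oo --> (0 : R).
Proof.
move=> /asboolP aN; apply/cvgrPdist_lt => e e0.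
have [q] := rat_in_itvoo e0.
rewrite in_itv /= ltr0q => /andP[q0 qe].
have [k hk] := aN q q0; exists k => // n /= kn.
rewrite sub0r normrN ger0_norm ?ler0q ?rat_padic_abs_ge0 //.
by apply: lt_trans qe; rewrite ltr_rat hk.
Qed.

Lemma padic_cauchy_abs_cvg a : cvgn (absR a).
Proof.
have [aN|/padic_abs_stationary [c _ [k hk]]] := boolP (a \in @padic_null p hp).
  by apply/cvg_ex; exists 0; exact: padic_null_cvg.
apply/cvg_ex; exists (ratr c); apply: cvg_near_cst.
by exists k => // n /= kn; rewrite hk.
Qed.

Lemma Qp_abs_class a : abs (Qp_class a) = limn (absR a).
Proof.
set r := Qp_repr (Qp_class a).
have : r - a \in @padic_null p hp.
  by rewrite -Qp_class_eq0 rmorphB /= /r Qp_reprK subrr.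
have [aN raN|aN /asboolP raN] := boolP (a \in @padic_null p hp).
  have rN : r \in @padic_null p hp by rewrite -[r](subrK a) rpredD.
  by rewrite /Qp_abs !(cvg_lim _ (padic_null_cvg _)).
have [c c0 [k hk]] := padic_abs_stationary aN; have [l hl] := raN c c0.
rewrite /Qp_abs -/r (lim_near_cst _ (l := ratr c : R)) //; last first.
  exists (maxn k l) => // n /=; rewrite geq_max => /andP[kn ln].
  by rewrite -(hk n kn); congr ratr; apply: rat_padic_abs_lt_eq => //;
    rewrite (hk n kn); exact: hl.
by apply/esym/lim_near_cst => //; exists k => // n /= kn; rewrite hk.
Qed.

Lemma Qp_abs_ge0 x : 0 <= abs x.
Proof.
apply: limr_ge; first exact: padic_cauchy_abs_cvg.
by apply: nearW => n; rewrite ler0q rat_padic_abs_ge0.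
Qed.

Lemma Qp_abs_eq0 x : (abs x == 0) = (x == 0).
Proof.
rewrite -(Qp_repr_null x) /Qp_abs.
have [xN|/padic_abs_stationary [c c0 [k hk]]] := boolP (_ \in _).
  by apply/eqP; apply: cvg_lim => //; exact: padic_null_cvg.
apply/negbTE; rewrite (_ : limn _ = ratr c :> R).
  by rewrite fmorph_eq0 gt_eqF.
by apply: lim_near_cst => //; exists k => // n /= kn; rewrite hk.
Qed.

Lemma Qp_absM x y : abs (x * y) = abs x * abs y.
Proof.
rewrite -{1}(Qp_reprK x) -{1}(Qp_reprK y) -rmorphM Qp_abs_class.
rewrite /Qp_abs -limM; try exact: padic_cauchy_abs_cvg.
by congr (lim (_ @ \oo)); apply/funext => n /=; rewrite -rmorphM -rat_padic_absM.
Qed.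

Let cvg_max (f g : nat -> R) (k l : R) : f @ \oo --> k -> g @ \oo --> l ->
  (f \max g) @ \oo --> Num.max k l.
Proof.
move=> fk gl; rewrite maxr_absE.
under eq_cvg do rewrite /= maxr_absE.
by apply: cvgMl; apply: cvgD; [exact: cvgD|apply: cvg_norm; exact: cvgB].
Qed.

Lemma Qp_absD x y : abs (x + y) <= Num.max (abs x) (abs y).
Proof.
rewrite -{1}(Qp_reprK x) -{1}(Qp_reprK y) -rmorphD Qp_abs_class.
have cx := @padic_cauchy_abs_cvg (Qp_repr x).
have cy := @padic_cauchy_abs_cvg (Qp_repr y).
rewrite (_ : Num.max _ _ =
    limn (absR (Qp_repr x) \max absR (Qp_repr y))); last first.
  by apply/esym/cvg_lim => //; exact: cvg_max.
apply: ler_lim; first exact: padic_cauchy_abs_cvg.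
  by apply: cvgP; exact: (cvg_max cx cy).
apply: nearW => n /=.
rewrite le_max !ler_rat -le_max; exact: rat_padic_absD.
Qed.

Lemma Qp_abs_rat (q : rat) : abs (ratr q) = ratr (rat_padic_abs p q).
Proof.
rewrite -(fmorph_eq_rat (@Qp_cst p hp)) Qp_abs_class.
by apply: lim_near_cst => //; apply: nearW.
Qed.

End QpAbs.

Section QpComplete.
Variables (R : realType) (p : nat) (hp : prime p).
Implicit Types (a : padic_cauchy_seq hp) (x : Qp hp).
Local Notation abs := (@Qp_abs R p hp).

Lemma Qp_absB_cst a (k : nat) (e : rat) :
  (forall n, (k <= n)%N -> rat_padic_abs p (a n - a k) < e) ->
  abs (Qp_class a - ratr (a k)) <= ratr e.
Proof.
move=> h; rewrite -(fmorph_eq_rat (@Qp_cst p hp)) -rmorphB Qp_abs_class.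
apply: limr_le; first exact: padic_cauchy_abs_cvg.
by exists k => // n /= kn; rewrite ler_rat ltW // h.
Qed.

Lemma Qp_dense x (e : R) : 0 < e -> exists q : rat, abs (x - ratr q) < e.
Proof.
move=> e0; have [d] := rat_in_itvoo e0; rewrite in_itv /= ltr0q => /andP[d0 de].
have [k hk] := asboolP _ (padic_seqP (Qp_repr x)) d d0.
exists (Qp_repr x k); rewrite -{1}(Qp_reprK x); apply: le_lt_trans de.
by apply: Qp_absB_cst => n kn; exact: hk.
Qed.

Lemma Qp_absN x : abs (- x) = abs x.
Proof.
rewrite -{1}(Qp_reprK x) -rmorphN Qp_abs_class; congr (limn _).
by apply/funext => n; rewrite -[padic_seq (- _) n]/(- _) rat_padic_absN.
Qed.

Lemma Qp_complete (X : nat -> Qp hp) :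
  (forall e : R, 0 < e -> exists k, forall m n, (k <= m)%N -> (k <= n)%N ->
     abs (X m - X n) < e) ->
  exists x, forall e : R, 0 < e -> exists k, forall n, (k <= n)%N ->
     abs (X n - x) < e.
Proof.
move=> XC; have [q hq] : exists q : nat -> rat,
    forall n, abs (X n - ratr (q n)) < n.+1%:R^-1.
  suff /choice[q hq] : forall n, exists q, abs (X n - ratr q) < n.+1%:R^-1 by exists q.
  by move=> n; apply: Qp_dense; rewrite invr_gt0.
have small (e : R) : 0 < e -> exists k, forall n, (k <= n)%N ->
    abs (X n - ratr (q n)) < e.
  move=> e0; have [k _ hk] := near_infty_natSinv_lt (PosNum e0).
  by exists k => n kn; apply: lt_trans (hk n kn).
have three (u v w : Qp hp) (e : R) : abs (u - v) < e -> abs (v - w) < e ->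
    abs (u - w) < e.
  move=> h1 h2; rewrite -[u](subrK v) -addrA.
  by apply: le_lt_trans (Qp_absD _ _ _) _; rewrite gt_max h1.
have symm (u v : Qp hp) : abs (u - v) = abs (v - u) by rewrite -Qp_absN opprB.
have qC : padic_cauchy hp q.
  apply/asboolP => e e0; have re0 : 0 < ratr e :> R by rewrite ltr0q.
  have [k hk] := XC _ re0; have [l hl] := small _ re0.
  exists (maxn k l) => m n; rewrite !geq_max => /andP[m1 m2] /andP[n1 n2].
  rewrite -(ltr_rat R) -(Qp_abs_rat R hp).
  rewrite -(fmorph_eq_rat (@Qp_cst p hp)) rmorphB /= !fmorph_eq_rat.
  by apply: (three _ (X m)); [rewrite symm hl|apply: (three _ (X n)); [exact: hk|exact: hl]].
pose a := PadicCauchySeq qC.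
exists (Qp_class a) => e e0.
have [d] := rat_in_itvoo e0; rewrite in_itv /= ltr0q => /andP[d0 de].
have [k hk] := small _ e0; have [l hl] := asboolP _ qC d d0.
exists (maxn k l) => n; rewrite geq_max => /andP[kn ln].
apply: (three _ (ratr (q n))); first exact: hk.
rewrite symm; apply: le_lt_trans de.
by apply: (@Qp_absB_cst a) => m nm; apply: hl => //; exact: leq_trans nm.
Qed.

End QpComplete.

Record is_norm (R : realType) (p : nat) (hp : prime p) (V : lmodType (Qp hp))
    (N : V -> R) : Prop := IsNorm {
  is_norm_ge0 : forall v, 0 <= N v;
  is_norm_eq0 : forall v, N v = 0 <-> v = 0;
  is_normZ : forall (x : Qp hp) v, N (x *: v) = Qp_abs R x * N v;
  is_norm_max : forall v w, N (v + w) <= Num.max (N v) (N w)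
}.

(* The default value 0 of the maximum is harmless: norms are nonnegative. *)
Definition orthogonal_basis (R : realType) (p : nat) (hp : prime p)
    (V : vectType (Qp hp)) (N : V -> R) (n : nat) (a : n.-tuple V) : Prop :=
  [/\ basis_of {:V} a,
      directv (\sum_(i < n) <[tnth a i]>),
      (\sum_(i < n) <[tnth a i]>)%VS = {:V}%VS
    & forall w : 'I_n -> V, (forall i, w i \in <[tnth a i]>%VS) ->
        N (\sum_(i < n) w i) = \big[Num.max/0]_(i < n) N (w i)].

(* Algorithms are programs of a random access machine with three memories,
   each indexed by nat, holding natural numbers (counters and addresses),
   p-adic numbers and real numbers. An expression is evaluated by exact
   arithmetic on the current contents of the memories, and its addresses may
   themselves be computed. The syntax mentions neither p, nor the dimension, nor
   any particular p-adic or real number, so a program is a finite text that can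
   be run on every input. *)

Inductive nat_exp : Type :=
| NatConst of nat
| NatLoad of nat_exp
| NatAdd of nat_exp & nat_exp
| NatSub of nat_exp & nat_exp
| NatMul of nat_exp & nat_exp.

Inductive field_exp : Type :=
| FieldNat of nat_exp
| FieldLoad of nat_exp
| FieldAdd of field_exp & field_exp
| FieldOpp of field_exp
| FieldMul of field_exp & field_exp
| FieldInv of field_exp.

Inductive test : Type :=
| NatLe of nat_exp & nat_exp
| QpEq of field_exp & field_exp
| RealLe of field_exp & field_exp
| Not of test
| And of test & test.

(* The first argument of an assignment or of a norm call is the address of the
   destination; the second argument of a norm call is the address of the first
   of the n coordinates of the vector. *)
Inductive program : Type :=
| Skip
| SetNat of nat_exp & nat_exp
| SetQp of nat_exp & field_exp
| SetReal of nat_exp & field_exp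
| CallN of nat_exp & nat_exp
| CallN' of nat_exp & nat_exp
| Seq of program & program
| If of test & program & program
| While of test & program.

Definition update (T : Type) (m : nat -> T) (a : nat) (x : T) : nat -> T :=
  fun b => if b == a then x else m b.

Record state (R : realType) (p : nat) (hp : prime p) : Type := State {
  nat_mem : nat -> nat;
  Qp_mem : nat -> Qp hp;
  real_mem : nat -> R
}.

Fixpoint nat_eval (m : nat -> nat) (e : nat_exp) : nat :=
  match e with
  | NatConst k => k
  | NatLoad a => m (nat_eval m a)
  | NatAdd e1 e2 => (nat_eval m e1 + nat_eval m e2)%N
  | NatSub e1 e2 => (nat_eval m e1 - nat_eval m e2)%N
  | NatMul e1 e2 => (nat_eval m e1 * nat_eval m e2)%N
  end.

Fixpoint field_eval (F : fieldType) (m : nat -> nat) (f : nat -> F)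
    (e : field_exp) : F :=
  match e with
  | FieldNat k => (nat_eval m k)%:R
  | FieldLoad a => f (nat_eval m a)
  | FieldAdd e1 e2 => field_eval m f e1 + field_eval m f e2
  | FieldOpp e1 => - field_eval m f e1
  | FieldMul e1 e2 => field_eval m f e1 * field_eval m f e2
  | FieldInv e1 => (field_eval m f e1)^-1
  end.

Section Execution.
Variables (R : realType) (p : nat) (hp : prime p) (V : vectType (Qp hp)).
Variables (n : nat) (u : n.-tuple V) (N N' : V -> R).
Implicit Types (s : state R hp) (c : program) (a : nat).

Definition eval_nat s (e : nat_exp) : nat := nat_eval (nat_mem s) e.
Definition eval_Qp s (e : field_exp) : Qp hp :=
  field_eval (nat_mem s) (Qp_mem s) e.
Definition eval_real s (e : field_exp) : R :=
  field_eval (nat_mem s) (real_mem s) e.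

Fixpoint eval_test s (t : test) : bool :=
  match t with
  | NatLe e1 e2 => (eval_nat s e1 <= eval_nat s e2)%N
  | QpEq e1 e2 => eval_Qp s e1 == eval_Qp s e2
  | RealLe e1 e2 => eval_real s e1 <= eval_real s e2
  | Not t1 => ~~ eval_test s t1
  | And t1 t2 => eval_test s t1 && eval_test s t2
  end.

Definition set_nat s a (k : nat) : state R hp :=
  State (update (nat_mem s) a k) (Qp_mem s) (real_mem s).
Definition set_Qp s a (x : Qp hp) : state R hp :=
  State (nat_mem s) (update (Qp_mem s) a x) (real_mem s).
Definition set_real s a (r : R) : state R hp :=
  State (nat_mem s) (Qp_mem s) (update (real_mem s) a r).

(* The vector whose coordinates in the basis u are stored from address a on. *)
Definition stored_vector s a : V :=
  \sum_(i < n) Qp_mem s (a + i)%N *: tnth u i.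

(* exec c s s' means that c, started in s, stops after finitely many steps in s'. *)
Inductive exec : program -> state R hp -> state R hp -> Prop :=
| ExecSkip s : exec Skip s s
| ExecSetNat d e s :
    exec (SetNat d e) s (set_nat s (eval_nat s d) (eval_nat s e))
| ExecSetQp d e s :
    exec (SetQp d e) s (set_Qp s (eval_nat s d) (eval_Qp s e))
| ExecSetReal d e s :
    exec (SetReal d e) s (set_real s (eval_nat s d) (eval_real s e))
| ExecCallN d e s :
    exec (CallN d e) s
      (set_real s (eval_nat s d) (N (stored_vector s (eval_nat s e))))
| ExecCallN' d e s :
    exec (CallN' d e) s
      (set_real s (eval_nat s d) (N' (stored_vector s (eval_nat s e))))
| ExecSeq c1 c2 s s1 s2 :
    exec c1 s s1 -> exec c2 s1 s2 -> exec (Seq c1 c2) s s2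
| ExecIfTrue t c1 c2 s s' :
    eval_test s t -> exec c1 s s' -> exec (If t c1 c2) s s'
| ExecIfFalse t c1 c2 s s' :
    ~~ eval_test s t -> exec c2 s s' -> exec (If t c1 c2) s s'
| ExecWhileStop t c s : ~~ eval_test s t -> exec (While t c) s s
| ExecWhileStep t c s s1 s2 :
    eval_test s t -> exec c s s1 -> exec (While t c) s1 s2 ->
    exec (While t c) s s2.

Lemma exec_deterministic c s s1 s2 : exec c s s1 -> exec c s s2 -> s1 = s2.
Proof.
move=> e; elim: e s2 => {c s s1}.
- by move=> s s2 e; inversion e.
- by move=> d e s s2 h; inversion h.
- by move=> d e s s2 h; inversion h.
- by move=> d e s s2 h; inversion h.
- by move=> d a s s2 h; inversion h.
- by move=> d a s s2 h; inversion h.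
- move=> c1 c2 s s1 s2 _ IH1 _ IH2 s3 h; inversion h; subst.
  by apply: IH2; rewrite (IH1 _ H1).
- move=> t c1 c2 s s1 ht _ IH s2 h; inversion h; subst; first exact: IH.
  by rewrite ht in H4.
- move=> t c1 c2 s s1 ht _ IH s2 h; inversion h; subst; last exact: IH.
  by rewrite H4 in ht.
- move=> t c s ht s2 h; inversion h; subst => //.
  by rewrite H1 in ht.
- move=> t c s s1 s2 ht _ IH1 _ IH2 s3 h; inversion h; subst.
    by rewrite ht in H3.
  by apply: IH2; rewrite (IH1 _ H2).
Qed.

(* The input consists of n and p at the natural addresses 0 and 1; the basis u
   and the norms are only reachable through the calls. *)
Definition initial_state : state R hp :=
  State (nth 0%N [:: n; p]) (fun=> 0) (fun=> 0).

(* The i-th output vector has its n coordinates from address i * n on. *)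
Definition output_basis s : n.-tuple V :=
  [tuple stored_vector s (i * n)%N | i < n].

End Execution.

Arguments initial_state R {p} hp n.

(* Main.v *)
(* The program searches: for K = p, p^2, ... it runs through all n x n matrices
   with natural entries below K, each row giving the coordinates of a vector a_i,
   and stops at the first one passing, for both norms, the finite test
     N(a_i) < K N(a_j) for all i, j, and
     N(a_i) <= N(\sum_l d_l a_l) whenever 0 <= d_l < K and d_i = 1.
   Soundness: if N(\sum_l x_l a_l) < |x_i| N(a_i), drop the nondominant terms and
   rescale so that the x_l are p-adic integers, one of them 1; reducing them
   modulo K violates the test.
   Termination: a common orthogonal basis exists, and by density of the natural
   numbers in the p-adic integers a perturbation of it passes the test. For the
   existence, start from an N-orthogonal basis and minimize the total N'-length
   among the N-orthogonal families with the same N-lengths; compactness makes N'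
   take finitely many values on vectors of given N-length, so a minimum exists,
   and it is N'-orthogonal. Applying this first to the sup norm of the given
   basis and N, then to N and N', yields the common basis. *)
Require Import Defs.
From HB Require Import structures.
From mathcomp Require Import all_boot all_order all_algebra.
From mathcomp Require Import all_classical all_reals all_analysis.
From mathcomp Require Import zify ring.
Set Implicit Arguments.
Unset Strict Implicit.
Unset Printing Implicit Defensive.
Import Order.TTheory GRing.Theory Num.Theory.
Local Open Scope ring_scope.

(** * The p-adic absolute value *)

Section PadicAbs.
Variables (R : realType) (p : nat) (hp : prime p).
Implicit Types x y : Qp hp.
Local Notation abs := (@Qp_abs R p hp).

Lemma Qp_abs0 : abs 0 = 0.
Proof. by apply/eqP; rewrite Qp_abs_eq0. Qed.

Lemma Qp_abs_cst q : abs (Qp_cst hp q) = ratr (rat_padic_abs p q).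
Proof. by rewrite fmorph_eq_rat Qp_abs_rat. Qed.

Lemma Qp_abs1 : abs 1 = 1.
Proof. by rewrite -(rmorph1 (@Qp_cst p hp)) Qp_abs_cst rat_padic_abs1 rmorph1. Qed.

Lemma Qp_abs_gt0 x : (0 < abs x) = (x != 0).
Proof. by rewrite lt_def Qp_abs_eq0 Qp_abs_ge0 andbT. Qed.

Lemma Qp_absV x : abs x^-1 = (abs x)^-1.
Proof.
have [->|x0] := eqVneq x 0; first by rewrite invr0 Qp_abs0 invr0.
apply: (@mulIf _ (abs x)); first by rewrite Qp_abs_eq0.
by rewrite -Qp_absM !mulVf ?Qp_abs_eq0 // Qp_abs1.
Qed.

Lemma Qp_absX x k : abs (x ^+ k) = abs x ^+ k.
Proof. by elim: k => [|k IH]; rewrite ?expr0 ?Qp_abs1 // !exprS Qp_absM IH. Qed.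

Lemma Qp_absB x y : abs (x - y) <= Num.max (abs x) (abs y).
Proof. by rewrite -(Qp_absN R y) Qp_absD. Qed.

Lemma Qp_abs_nat k : abs k%:R <= 1.
Proof.
elim: k => [|k IH]; first by rewrite Qp_abs0.
by rewrite -addn1 natrD (le_trans (Qp_absD _ _ _)) // ge_max IH Qp_abs1 lexx.
Qed.

Lemma Qp_abs_int (z : int) : abs z%:~R <= 1.
Proof.
by case: z => k; rewrite ?NegzE ?rmorphN /= ?Qp_absN -?pmulrn Qp_abs_nat.
Qed.

Lemma Qp_abs_p : abs p%:R = p%:R^-1.
Proof.
rewrite -(rmorph_nat (@Qp_cst p hp)) Qp_abs_cst.
have := @rat_padic_abs_frac p hp p 1; rewrite divr1 -pmulrn => ->; last first.
- by [].
- by rewrite eqz_nat -lt0n prime_gt0.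
by rewrite logn1 /= logn_prime // eqxx mul1r rmorphV /= ?ratr_nat // unitfE pnatr_eq0 -lt0n prime_gt0.
Qed.

Let p_gt1 : 1 < p%:R :> R.
Proof. by rewrite ltr1n prime_gt1. Qed.

Let p_gt0 : 0 < p%:R :> R.
Proof. by rewrite ltr0n prime_gt0. Qed.

Lemma Qp_p_neq0 : p%:R != 0 :> Qp hp.
Proof. by rewrite -Qp_abs_gt0 Qp_abs_p invr_gt0. Qed.

Lemma Qp_abs_pX k : abs (p%:R ^+ k) = p%:R ^- k.
Proof. by rewrite Qp_absX Qp_abs_p exprVn. Qed.

Lemma pXV_gt0 k : 0 < p%:R ^- k :> R.
Proof. by rewrite invr_gt0 exprn_gt0. Qed.

Lemma pXV_le1 k : p%:R ^- k <= 1 :> R.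
Proof. by rewrite invf_le1 ?exprn_gt0 // exprn_ege1 // ltW. Qed.

Lemma pXV_le k l : (k <= l)%N -> p%:R ^- l <= p%:R ^- k :> R.
Proof. by move=> kl; rewrite lef_pV2 ?posrE ?exprn_gt0 // ler_weXn2l // ltW. Qed.

Lemma pXV_small (e : R) : 0 < e -> exists k, forall l, (k <= l)%N -> p%:R ^- l < e.
Proof.
move=> e0; have [k _ hk] := near_infty_natSinv_lt (PosNum e0).
exists k.+1 => l kl; apply: le_lt_trans (hk k (leqnn k)).
apply: le_trans (pXV_le kl) _.
rewrite lef_pV2 ?posrE ?exprn_gt0 ?ltr0n ?(prime_gt0 hp) //.
by rewrite -natrX ler_nat ltnW // ltn_expl // prime_gt1.
Qed.

Lemma Qp_abs_leM1 x y : abs x <= 1 -> abs y <= 1 -> abs (x * y) <= 1.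
Proof. by move=> x1 y1; rewrite Qp_absM mulr_ile1 // Qp_abs_ge0. Qed.

Lemma Qp_abs_leD1 x y : abs x <= 1 -> abs y <= 1 -> abs (x + y) <= 1.
Proof. by move=> x1 y1; rewrite (le_trans (Qp_absD _ _ _)) // ge_max x1. Qed.

(** By density [x] is close to a rational, whose denominator is prime to [p] because its absolute
    value is at most 1. Inverting the denominator modulo [p ^ e] by Bezout and reducing modulo
    [p ^ e] gives the natural number. *)
Lemma Qp_approx_nat x e : abs x <= 1 ->
  exists2 d : nat, (d < p ^ e)%N & abs (x - d%:R) <= p%:R ^- e.
Proof.
move=> x1; have [q] := Qp_dense x (pXV_gt0 e); rewrite -(fmorph_eq_rat (@Qp_cst p hp)).
set Q := Qp_cst hp q => xq.
have q1 : abs Q <= 1.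
  have -> : Q = x - (x - Q) by ring.
  apply: le_trans (Qp_absB _ _) _; rewrite ge_max x1 /=.
  exact: le_trans (ltW xq) (pXV_le1 e).
pose D : Qp hp := (denq q)%:~R; pose M : Qp hp := (numq q)%:~R.
have qD : Q * D = M.
  rewrite /D /M -!(rmorph_int (@Qp_cst p hp)).
  by rewrite -rmorphM /= -{1}(divq_num_den q) divfK // intr_eq0 denq_neq0.
(* If [p] divided the denominator, Bezout for numerator and denominator would write 1 as a p-adic
   integer times [p], forcing [abs p%:R] to be at least 1. *)
have cop : coprimez (denq q) (p ^ e)%N%:Z.
  rewrite coprimezE /= coprimeXr // coprime_sym prime_coprime //.
  apply/negP => /dvdnP[k dk].
  have := coprime_num_den q.
  rewrite -/(coprimez (numq q) (denq q)) => /coprimezP[[u v] /= uv].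
  have kpD : D = k%:R * p%:R.
    by rewrite -natrM -dk /D -{1}(gtz0_abs (denq_gt0 q)) -pmulrn.
  have /(congr1 abs) : (u%:~R * Q + v%:~R) * k%:R * p%:R = 1.
    by rewrite -mulrA -kpD mulrDl -mulrA qD -!rmorphM -rmorphD /= uv.
  rewrite Qp_abs1 Qp_absM => h.
  have : 1 <= abs p%:R.
    rewrite -h ler_piMl ?Qp_abs_ge0 //; apply: Qp_abs_leM1 (Qp_abs_nat k).
    exact: Qp_abs_leD1 (Qp_abs_leM1 (Qp_abs_int u) q1) (Qp_abs_int v).
  by rewrite Qp_abs_p leNgt invf_lt1 // p_gt1.
have /coprimezP[[v u] /= uv] := cop.
pose P : Qp hp := p%:R ^+ e.
have PE : (p ^ e)%N%:Z%:~R = P by rewrite -pmulrn natrX.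
have absPz (y : Qp hp) : abs y <= 1 -> abs (y * P) <= p%:R ^- e.
  by move=> y1; rewrite Qp_absM Qp_abs_pX ler_piMl // ltW // pXV_gt0.
have pe0 : (p ^ e)%N%:Z != 0 by rewrite eqz_nat expn_eq0 negb_and -lt0n prime_gt0.
pose z := (numq q * v)%R; pose d := (z %% (p ^ e)%N)%Z.
have d0 : 0 <= d by apply: modz_ge0.
exists `|d|%N.
  by rewrite -ltz_nat gez0_abs // ltz_pmod // ltz_nat expn_gt0 prime_gt0.
have -> : (`|d|%N)%:R = d%:~R :> Qp hp by rewrite -{2}(gez0_abs d0) -pmulrn.
have zE : z%:~R = (z %/ (p ^ e)%N)%Z%:~R * P + d%:~R :> Qp hp.
  by rewrite {1}(divz_eq z (p ^ e)%N) rmorphD rmorphM /= PE.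
have uvE : v%:~R * D + u%:~R * P = 1.
  by rewrite -PE -!rmorphM -rmorphD /= uv.
(* Both [Q - z] and [z - d] are p-adic integer multiples of [P]: the first by the Bezout relation
   [uvE], the second by Euclidean division. *)
have -> : x - d%:~R = (x - Q) + (Q * u%:~R + (z %/ (p ^ e)%N)%Z%:~R) * P.
  have dE : d%:~R = Q * D * v%:~R - (z %/ (p ^ e)%N)%Z%:~R * P.
    by apply/(canRL (addrK _)); rewrite addrC -zE qD -rmorphM.
  move: dE uvE; move: (d%:~R) (_ %/ _)%Z%:~R (v%:~R) (u%:~R) => d' k' v' u' -> E.
  have -> : x - (Q * D * v' - k' * P) =
      (x - Q) + (Q * u' + k') * P + Q * (1 - (v' * D + u' * P)) by ring.
  by rewrite E subrr mulr0 addr0.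
apply: le_trans (Qp_absD _ _ _) _; rewrite ge_max ltW //=.
exact: absPz (Qp_abs_leD1 (Qp_abs_leM1 q1 (Qp_abs_int u)) (Qp_abs_int _)).
Qed.

Lemma Qp_abs_le1_scale x : exists k, forall l, (k <= l)%N -> abs (p%:R ^+ l * x) <= 1.
Proof.
have [|k hk] := @pXV_small (abs x + 1)^-1.
  by rewrite invr_gt0 ltr_wpDl ?Qp_abs_ge0.
exists k => l /hk /ltW h; rewrite Qp_absM Qp_abs_pX.
apply: le_trans (ler_wpM2r (Qp_abs_ge0 R x) h) _.
by rewrite mulrC ler_pdivrMr ?mul1r ?lerDl // ltr_wpDl ?Qp_abs_ge0.
Qed.

End PadicAbs.

(** * Norms and orthogonal families *)

Section Norms.
Variables (R : realType) (p : nat) (hp : prime p) (V : lmodType (Qp hp)).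
Local Notation abs := (@Qp_abs R p hp).
Implicit Types (x y : Qp hp) (v w : V).

Section OneNorm.
Variables (N : V -> R) (normN : is_norm N).

Lemma norm0 : N 0 = 0.
Proof. exact/(is_norm_eq0 normN). Qed.

Lemma norm_ge0 v : 0 <= N v.
Proof. exact: is_norm_ge0. Qed.

Lemma norm_eq0 v : (N v == 0) = (v == 0).
Proof. by apply/eqP/eqP => /(is_norm_eq0 normN). Qed.

Lemma norm_gt0 v : (0 < N v) = (v != 0).
Proof. by rewrite lt_def norm_eq0 norm_ge0 andbT. Qed.

Lemma normZ x v : N (x *: v) = abs x * N v.
Proof. exact: is_normZ. Qed.

Lemma normN1 v : N (- v) = N v.
Proof. by rewrite -scaleN1r normZ Qp_absN Qp_abs1 mul1r. Qed.

Lemma norm_leD v w (m : R) : N v <= m -> N w <= m -> N (v + w) <= m.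
Proof. by move=> h1 h2; rewrite (le_trans (is_norm_max normN v w)) // ge_max h1. Qed.

Lemma norm_ltD v w (m : R) : N v < m -> N w < m -> N (v + w) < m.
Proof. by move=> h1 h2; rewrite (le_lt_trans (is_norm_max normN v w)) // gt_max h1. Qed.

Lemma norm_le_sum n (P : pred 'I_n) (F : 'I_n -> V) (m : R) : 0 <= m ->
  (forall i, P i -> N (F i) <= m) -> N (\sum_(i < n | P i) F i) <= m.
Proof. by move=> m0 h; apply: (big_ind (fun t => N t <= m)) => //; [rewrite norm0|move=> v w; exact: norm_leD]. Qed.

Lemma norm_lt_sum n (P : pred 'I_n) (F : 'I_n -> V) (m : R) : 0 < m ->
  (forall i, P i -> N (F i) < m) -> N (\sum_(i < n | P i) F i) < m.
Proof. by move=> m0 h; apply: (big_ind (fun t => N t < m)) => //; [rewrite norm0|move=> v w; exact: norm_ltD]. Qed.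

(** Ultrametric triangles are isosceles: if [N v] were also below [N w], then [w], the difference of
    [v] and [v - w], would be shorter than itself. *)
Lemma norm_lt_eq v w : N (v - w) < N w -> N v = N w.
Proof.
move=> h; apply/eqP; rewrite eq_le; apply/andP; split.
  by rewrite -[v](subrK w) norm_leD // ltW.
rewrite leNgt; apply/negP => h'.
have := norm_ltD h' (eq_ind_r (fun t => t < N w) h (normN1 (v - w))).
by rewrite opprB addrC subrK ltxx.
Qed.

End OneNorm.

(** Only the lower bound on the norm of a sum is required, as the ultrametric inequality supplies
    the other half of the maximum formula. Together with the nonvanishing it also yields linear
    independence. *)
Definition orthogonal_family (N : V -> R) n (v : 'I_n -> V) : Prop :=
  (forall i, v i != 0) /\
  forall (x : 'I_n -> Qp hp) i, abs (x i) * N (v i) <= N (\sum_j x j *: v j).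

Section OneNormOrthogonal.
Variables (N : V -> R) (normN : is_norm N).
Variables (n : nat) (v : 'I_n -> V).

Lemma norm_orthogonal_family (x : 'I_n -> Qp hp) : orthogonal_family N v ->
  N (\sum_i x i *: v i) = \big[Num.max/0]_(i < n) N (x i *: v i).
Proof.
case=> _ ov; apply/eqP; rewrite eq_le; apply/andP; split.
  apply: (norm_le_sum normN); first exact: bigmax_ge_id.
  by move=> i _; exact: le_bigmax.
apply: bigmax_le; first exact: norm_ge0.
by move=> i _; rewrite normZ.
Qed.

(* Keep the dominant terms only, and normalize the one of largest weight. *)
Lemma orthogonal_family_defect (x : 'I_n -> Qp hp) (i0 : 'I_n) (g : 'I_n -> R) :
  N (\sum_i x i *: v i) < abs (x i0) * N (v i0) ->
  exists z : 'I_n -> Qp hp, exists i1 : 'I_n,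
    [/\ z i1 = 1, forall j, 0 <= g j -> 0 <= g i1 -> abs (z j) * g j <= g i1,
        forall j, abs (z j) * N (v j) <= N (v i1)
      & N (\sum_j z j *: v j) < N (v i1)].
Proof.
move=> hx; pose f i := abs (x i) * N (v i).
have [k _ kmax] := @arg_maxP _ _ _ i0 xpredT f isT.
pose I := [pred i | f i == f k].
(* The free weight [g] breaks ties among dominant terms. With [g] constantly 1 the rescaled
   coefficients are p-adic integers; with [g] a second norm the combination stays short for that
   norm too. *)
have [i1 /eqP Ii1 i1max] := @arg_maxP _ _ _ k I (fun i => abs (x i) * g i) (eqxx _).
have m0 : 0 < f k.
  by apply: lt_le_trans (kmax i0 isT); apply: le_lt_trans hx; exact: norm_ge0.
have xi1 : x i1 != 0.
  by apply/eqP => h; move: m0; rewrite -Ii1 /f h Qp_abs0 mul0r ltxx.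
have ax0 : 0 < abs (x i1) by rewrite Qp_abs_gt0.
pose z j := if I j then x j / x i1 else 0.
have absz j : I j -> abs (z j) = abs (x j) / abs (x i1).
  by rewrite /z => ->; rewrite Qp_absM Qp_absV.
exists z, i1; split.
- by rewrite /z /= Ii1 eqxx divff.
- move=> j gj gi1; case: (boolP (I j)) => Ij; last first.
    by rewrite /z (negbTE Ij) Qp_abs0 mul0r.
  by rewrite absz // mulrAC ler_pdivrMr // [leRHS]mulrC; exact: i1max.
- move=> j; case: (boolP (I j)) => Ij; last first.
    by rewrite /z (negbTE Ij) Qp_abs0 mul0r norm_ge0.
  rewrite absz // mulrAC ler_pdivrMr // [leRHS]mulrC -/(f i1) -/(f j) Ii1.
  by rewrite (eqP Ij).
(* The whole sum and each discarded term lie strictly below the dominant value [f k], hence so does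
   what remains. *)
have -> : \sum_j z j *: v j =
    (x i1)^-1 *: (\sum_j x j *: v j - \sum_(j | ~~ I j) x j *: v j).
  rewrite [X in _ *: (X - _)](bigID I) /= addrK scaler_sumr (bigID I) /=.
  rewrite [X in _ + X]big1 ?addr0 => [|j /negbTE Ij]; last first.
    by rewrite /z /= Ij scale0r.
  by apply: eq_bigr => j Ij; rewrite /z /= Ij scalerA mulrC.
rewrite normZ // Qp_absV ltr_pdivrMl // -/(f i1) Ii1.
apply: norm_ltD => //; first exact: lt_le_trans hx (kmax i0 isT).
rewrite normN1 //; apply: norm_lt_sum => // j Ij.
by rewrite normZ // lt_neqAle Ij; exact: kmax.
Qed.

(** The errors contribute less than the dominant term of a combination of [v], and that term bounds
    the norm of the combination from below; so the perturbed combination has the same norm. *)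
Lemma orthogonal_family_perturb (w : 'I_n -> V) : orthogonal_family N v ->
  (forall i, N (w i - v i) < N (v i)) -> orthogonal_family N w.
Proof.
case=> v0 ov hw.
have Nw i : N (w i) = N (v i) by exact: norm_lt_eq.
split=> [i|x i]; first by rewrite -(norm_gt0 normN) Nw (norm_gt0 normN).
have [k _ kmax] := @arg_maxP _ _ _ i xpredT (fun i => abs (x i) * N (v i)) isT.
rewrite Nw; apply: le_trans (kmax i isT) _.
have [xk0|xk0] := eqVneq (x k) 0; first by rewrite xk0 Qp_abs0 mul0r norm_ge0.
have m0 : 0 < abs (x k) * N (v k) by rewrite mulr_gt0 ?Qp_abs_gt0 ?norm_gt0.
apply: le_trans (ov x k) _; rewrite le_eqVlt; apply/orP; left; apply/eqP/esym.
apply: (norm_lt_eq normN); rewrite -sumrB; apply: lt_le_trans (ov x k).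
apply: norm_lt_sum => // j _; rewrite -scalerBr normZ //.
have [->|xj0] := eqVneq (x j) 0; first by rewrite Qp_abs0 mul0r.
by apply: lt_le_trans (kmax j isT); rewrite ltr_pM2l ?Qp_abs_gt0.
Qed.

Lemma orthogonal_familyZ (c : 'I_n -> Qp hp) : (forall i, c i != 0) ->
  orthogonal_family N v -> orthogonal_family N (fun i => c i *: v i).
Proof.
move=> c0 [v0 ov]; split=> [i|x i]; first by rewrite scaler_eq0 negb_or c0 v0.
rewrite normZ // mulrA -Qp_absM.
have := ov (fun i => x i * c i) i.
by under eq_bigr do rewrite -scalerA.
Qed.

End OneNormOrthogonal.
End Norms.

Lemma finite_argmin (R : realType) (T : Type) (P : T -> Prop) (f : T -> R) (L : seq R) :
  (forall x, P x -> f x \in L) -> (exists x, P x) ->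
  exists2 x, P x & forall y, P y -> f x <= f y.
Proof.
elim: L P => [|a L IH] P PL [x0 Px0]; first by have := PL x0 Px0.
have [[x [Px fx]]|no_lt] := pselect (exists x, P x /\ f x < a).
  have [||z [Pz fz] zmin] := IH (fun x => P x /\ f x < a).
  - by move=> y [Py fy]; have := PL y Py; rewrite inE lt_eqF.
  - by exists x.
  exists z => // y Py; have [fya|fya] := ltP (f y) a; first exact: zmin.
  exact: le_trans (ltW fz) fya.
have ge_a y : P y -> a <= f y.
  by move=> Py; rewrite leNgt; apply/negP => fy; apply: no_lt; exists y.
have [[x [Px fx]]|no_eq] := pselect (exists x, P x /\ f x = a).
  by exists x => // y; rewrite fx; exact: ge_a.
apply: IH; last by exists x0.
move=> y Py; have := PL y Py; rewrite inE => /orP[/eqP fy|//].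
by case: no_eq; exists y.
Qed.

(** * Compactness *)

Section Compactness.
Variables (R : realType) (p : nat) (hp : prime p) (n : nat).
Local Notation abs := (@Qp_abs R p hp).
Implicit Types (c x y : 'I_n -> Qp hp).

(** This replaces a compactness argument: dependent choice produces a sequence of centres whose
    successive distances make it Cauchy in each coordinate, and completeness gives the limit [x]. *)
Lemma Qp_nested_balls (P : ('I_n -> Qp hp) -> nat -> Prop) c0 : P c0 0%N ->
  (forall c e, P c e -> exists2 c', P c' e.+1 & forall i, abs (c' i - c i) <= p%:R ^- e) ->
  exists x, forall e, exists2 c, P c e & forall i, abs (c i - x i) <= p%:R ^- e.
Proof.
move=> P0 Pstep.
have /choice[nxt hnxt] : forall q : ('I_n -> Qp hp) * nat, exists c',
    P q.1 q.2 -> P c' q.2.+1 /\ forall i, abs (c' i - q.1 i) <= p%:R ^- q.2.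
  move=> q; have [Pq|Pq] := pselect (P q.1 q.2); last by exists q.1.
  by have [c' ? ?] := Pstep _ _ Pq; exists c'.
pose s := fix s e := if e is e'.+1 then nxt (s e', e') else c0.
have Ps e : P (s e) e by elim: e => //= e IH; case: (hnxt (s e, e)).
have sS e i : abs (s e.+1 i - s e i) <= p%:R ^- e.
  by case: (hnxt (s e, e) (Ps e)) => _; exact.
clearbody s; have sC e m i : (e <= m)%N -> abs (s m i - s e i) <= p%:R ^- e.
  move=> em; rewrite -(subnK em); elim: (m - e)%N => [|d IH].
    by rewrite subrr Qp_abs0 ltW // pXV_gt0.
  have -> : s (d.+1 + e)%N i - s e i =
      (s (d + e)%N.+1 i - s (d + e)%N i) + (s (d + e)%N i - s e i).
    by rewrite addrA subrK.
  rewrite (le_trans (Qp_absD _ _ _)) // ge_max IH andbT.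
  by rewrite (le_trans (sS _ _)) // pXV_le // leq_addl.
have /choice[x hx] : forall i, exists xi, forall e : R, 0 < e ->
    exists k, forall m, (k <= m)%N -> abs (s m i - xi) < e.
  move=> i; apply: Qp_complete => e e0.
  have [k hk] := pXV_small hp e0; exists k => l m kl km.
  have -> : s l i - s m i = (s l i - s k i) - (s m i - s k i) by ring.
  rewrite (le_lt_trans (Qp_absB _ _ _)) // gt_max.
  by rewrite !(le_lt_trans (sC k _ i _)) // hk.
exists x => e; exists (s e) => // i.
have [k hk] := hx i _ (pXV_gt0 R hp e); pose m := maxn k e.
have -> : s e i - x i = (s m i - x i) - (s m i - s e i) by ring.
apply: le_trans (Qp_absB _ _ _) _.
by rewrite ge_max (sC _ _ i (leq_maxr k e)) ltW // hk // leq_maxl.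
Qed.

End Compactness.

Section FiniteValues.
Variables (R : realType) (p : nat) (hp : prime p) (V : lmodType (Qp hp)).
Variables (N : V -> R) (normN : is_norm N) (n : nat) (u : 'I_n -> V).
Local Notation abs := (@Qp_abs R p hp).

Lemma norm_approx_lt (m : R) : 0 < m -> exists k, forall l (x y : 'I_n -> Qp hp),
  (k <= l)%N -> (forall i, abs (y i - x i) <= p%:R ^- l) ->
  N (\sum_i y i *: u i - \sum_i x i *: u i) < m.
Proof.
(* The summand 1 keeps [C] positive even for an empty family. *)
move=> m0; pose C := 1 + \sum_i N (u i).
have C0 : 0 < C by rewrite ltr_wpDr // sumr_ge0 // => i _; exact: norm_ge0.
have NC i : N (u i) <= C.
  rewrite /C (bigD1 i) //= addrCA lerDl addr_ge0 // sumr_ge0 // => j _.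
  exact: norm_ge0.
have [k hk] := pXV_small hp (divr_gt0 m0 C0); exists k => l x y kl hxy.
rewrite -sumrB; apply: norm_lt_sum => // i _; rewrite -scalerBl normZ //.
apply: le_lt_trans (_ : p%:R ^- l * C < m); last by rewrite -ltr_pdivlMr // hk.
by rewrite ler_pM ?Qp_abs_ge0 ?norm_ge0.
Qed.

Hypothesis free_u : forall c, \sum_i c i *: u i = 0 -> forall i, c i = 0.

(* If the norm took infinitely many values on the unit ball of coordinates, it
   would do so on balls shrinking to some x; but near a nonzero vector it is
   constant. *)
Lemma norm_finite_values_ball (d : R) : 0 < d -> exists L : seq R,
  forall c, (forall i, abs (c i) <= 1) -> (exists i, d <= abs (c i)) ->
  N (\sum_i c i *: u i) \in L.
Proof.
move=> d0.
pose fin c e := exists L : seq R, forall y, (forall i, abs (y i - c i) <= p%:R ^- e) ->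
  (exists i, d <= abs (y i)) -> N (\sum_i y i *: u i) \in L.
suff [L hL] : fin (fun=> 0) 0%N.
  by exists L => c c1; apply: hL => i; rewrite subr0 expr0 invr1.
apply: contrapT => nf.
have [|x hx] := Qp_nested_balls (P := fun c e => ~ fin c e) (R := R) nf.
  move=> c e nfc; apply: contrapT => H; apply: nfc.
  (* The ball is covered by finitely many balls of radius [p%:R ^- e.+1], whose centres are [c]
     shifted by [p%:R ^+ e] times a vector of digits [g]. If each carried finitely many values, so
     would their union. *)
  have /choice[L hL] : forall g : {ffun 'I_n -> 'I_p}, exists Lg : seq R, forall y,
      (forall i, abs (y i - (c i + p%:R ^+ e * (g i)%:R)) <= p%:R ^- e.+1) ->
      (exists i, d <= abs (y i)) -> N (\sum_i y i *: u i) \in Lg.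
    move=> g; apply: contrapT => ng; apply: H.
    exists (fun i => c i + p%:R ^+ e * (g i)%:R) => // i.
    rewrite addrC addKr Qp_absM Qp_abs_pX.
    by rewrite ler_piMr ?Qp_abs_nat // ltW // pXV_gt0.
  exists (flatten [seq L g | g <- enum {ffun 'I_n -> 'I_p}]) => y yc yd.
  have /choice[g hg] : forall i, exists gi : 'I_p,
      abs ((y i - c i) / p%:R ^+ e - gi%:R) <= p%:R^-1.
    move=> i; have [|k kp hk] := @Qp_approx_nat R p hp ((y i - c i) / p%:R ^+ e) 1.
      rewrite Qp_absM Qp_absV Qp_abs_pX invrK.
      by rewrite -ler_pdivlMr ?mul1r ?yc // exprn_gt0 // ltr0n prime_gt0.
    by rewrite expn1 in kp; exists (Ordinal kp).
  apply/flattenP; exists (L (finfun g)); first by apply: map_f; rewrite mem_enum.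
  apply: hL => // i; rewrite ffunE.
  have pe0 : p%:R ^+ e != 0 :> Qp hp by rewrite expf_neq0 // Qp_p_neq0.
  have -> : y i - (c i + p%:R ^+ e * (g i)%:R) =
      p%:R ^+ e * ((y i - c i) / p%:R ^+ e - (g i)%:R).
    by rewrite mulrBr mulrCA divff // mulr1 opprD addrA.
  rewrite Qp_absM Qp_abs_pX exprS invfM [leRHS]mulrC.
  by rewrite ler_pM2l // pXV_gt0.
have ball_x c e y : (forall i, abs (c i - x i) <= p%:R ^- e) ->
    (forall i, abs (y i - c i) <= p%:R ^- e) -> forall i, abs (y i - x i) <= p%:R ^- e.
  move=> cx yc i; have -> : y i - x i = (y i - c i) + (c i - x i) by ring.
  by rewrite (le_trans (Qp_absD _ _ _)) // ge_max yc cx.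
pose v := \sum_i x i *: u i.
(* At the limit either all coordinates vanish, and then small balls contain no point with a
   coordinate of size at least [d], or the norm is constant on a small ball. Both contradict
   [nfc]. *)
have [v0|v0] := eqVneq v 0.
  have [k hk] := pXV_small hp d0; have [c nfc cx] := hx k; apply: nfc.
  exists [::] => y yc [i]; rewrite leNgt => /negP; case.
  rewrite -[y i]subr0 -[0](free_u v0 i).
  exact: le_lt_trans (ball_x c k y cx yc i) (hk k (leqnn k)).
have [|k hk] := @norm_approx_lt (N v); first by rewrite norm_gt0.
have [c nfc cx] := hx k; apply: nfc.
exists [:: N v] => y yc _; rewrite inE; apply/eqP; apply: (norm_lt_eq normN).
exact: hk (leqnn k) (ball_x c k y cx yc).
Qed.

End FiniteValues.

(** * Simultaneous orthogonalization of two norms *)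

Section CommonBasis.
Variables (R : realType) (p : nat) (hp : prime p) (V : lmodType (Qp hp)).
Variables (N N' : V -> R) (normN : is_norm N) (normN' : is_norm N').
Variables (n : nat) (a : 'I_n -> V).
Hypothesis ortha : orthogonal_family N a.
Hypothesis spana : forall v, exists x, v = \sum_i x i *: a i.
Local Notation abs := (@Qp_abs R p hp).

Lemma orthogonal_family_free (c : 'I_n -> Qp hp) :
  \sum_i c i *: a i = 0 -> forall i, c i = 0.
Proof.
move=> c0 i; have := ortha.2 c i; rewrite c0 norm0 // => h.
apply/eqP; rewrite -(Qp_abs_eq0 R); have : abs (c i) * N (a i) == 0.
  by rewrite eq_le h mulr_ge0 ?Qp_abs_ge0 ?norm_ge0.
by rewrite mulf_eq0 (norm_eq0 normN) (negbTE (ortha.1 i)) orbF.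
Qed.

Lemma norm_finite_values (r : R) : 0 < r ->
  exists L : seq R, forall v, N v = r -> N' v \in L.
Proof.
move=> r0; have a0 i : 0 < N (a i) by rewrite norm_gt0 //; exact: ortha.1.
pose C := 1 + \sum_i N (a i); pose D := \sum_i (N (a i))^-1.
have C0 : 0 < C by rewrite ltr_wpDr // sumr_ge0 // => i _; exact: norm_ge0.
have NC i : N (a i) <= C.
  rewrite /C (bigD1 i) //= addrCA lerDl addr_ge0 // sumr_ge0 // => j _.
  exact: norm_ge0.
have ND i : (N (a i))^-1 <= D.
  by rewrite /D (bigD1 i) //= lerDl sumr_ge0 // => j _; rewrite invr_ge0 norm_ge0.
have rD : 0 <= r * D by rewrite mulr_ge0 ?(ltW r0) // sumr_ge0 // => j _; rewrite invr_ge0 norm_ge0.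
have [|k hk] := @pXV_small R p hp (1 + r * D)^-1; first by rewrite invr_gt0 ltr_wpDr.
have P0 : 0 < p%:R ^- k :> R := pXV_gt0 R hp k.
(* A vector of length [r] has a coordinate of size at least [r / C], since otherwise every term
   would be shorter than [r]. Its coordinates are at most [r * D], so multiplying by [p%:R ^+ k]
   makes them integral, at the price of the factor [p%:R ^- k] in [d]. *)
have [|L hL] := norm_finite_values_ball normN' orthogonal_family_free (d := p%:R ^- k * (r / C)).
  by rewrite mulr_gt0 // divr_gt0.
exists [seq p%:R ^+ k * t | t <- L] => v Nv; have [x vx] := spana v.
apply/mapP; exists (N' (\sum_i (p%:R ^+ k * x i) *: a i)); last first.
  under eq_bigr do rewrite -scalerA.
  rewrite -scaler_sumr -vx normZ // Qp_abs_pX mulrA divff ?mul1r //.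
  by rewrite -invr_eq0 gt_eqF.
have ox i : abs (x i) * N (a i) <= r by rewrite -Nv vx; exact: ortha.2.
apply: hL => [i|].
  rewrite Qp_absM Qp_abs_pX.
  have h1 : abs (x i) <= 1 + r * D.
    have : abs (x i) <= r / N (a i) by rewrite ler_pdivlMr.
    move=> /le_trans; apply; apply: le_trans (ler_wpM2l (ltW r0) (ND i)) _.
    by rewrite lerDr.
  apply: le_trans (ler_pM (ltW P0) (Qp_abs_ge0 _ _) (ltW (hk k (leqnn k))) h1) _.
  by rewrite mulVf // gt_eqF // ltr_wpDr.
apply: contrapT => no; suff : N v < r by rewrite Nv ltxx.
rewrite vx; apply: norm_lt_sum => // i _; rewrite normZ // ltNge; apply/negP => h.
apply: no; exists i; rewrite Qp_absM Qp_abs_pX ler_pM2l // ler_pdivrMr //.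
by apply: le_trans h _; rewrite ler_wpM2l ?Qp_abs_ge0.
Qed.

(* Among the N-orthogonal families with prescribed N-lengths, one minimizing the
   total N'-length is N'-orthogonal: a defect would give a shorter vector that
   can replace one of the family. *)
Lemma exists_common_orthogonal : exists v : 'I_n -> V, orthogonal_family N v /\ orthogonal_family N' v.
Proof.
pose S (v : 'I_n -> V) := orthogonal_family N v /\ forall i, N (v i) = N (a i).
have /choice[LL hLL] : forall i, exists Li : seq R, forall v, N v = N (a i) -> N' v \in Li.
  by move=> i; apply: norm_finite_values; rewrite norm_gt0 //; exact: ortha.1.
pose L := flatten [seq LL i | i <- enum 'I_n].
have hL i v : N v = N (a i) -> N' v \in L.
  by move=> h; apply/flattenP; exists (LL i); [apply: map_f; rewrite mem_enum|exact: hLL].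
pose f (v : 'I_n -> V) := \sum_i N' (v i).
(* On [S] every value of [f] is a sum of entries of [L], selected by an index function [g]; there
   are finitely many such sums. *)
have [||v [ov Nv] vmin] := @finite_argmin R _ S f
    [seq \sum_i nth 0 L (g i) | g : {ffun 'I_n -> 'I_(size L)}].
- move=> v [_ Nv]; have hi i : (index (N' (v i)) L < size L)%N.
    by rewrite index_mem (hL i).
  apply/mapP; exists [ffun i => Ordinal (hi i)]; first by rewrite mem_enum.
  by apply: eq_bigr => i _; rewrite ffunE /= nth_index // (hL i).
- by exists a; split.
exists v; split=> //; split; first exact: ov.1.
move=> x i0; rewrite leNgt; apply/negP => hx.
(* The weight is the [N]-length, so that the [N']-shorter vector [w] keeps the [N]-length of [v k]:
   at most by [zg], at least by orthogonality and [z k = 1]. *)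
have [z [k [zk zg _ zlt]]] := orthogonal_family_defect normN' (fun i => N (v i)) hx.
have {}zg j : abs (z j) * N (v j) <= N (v k) by apply: zg; exact: norm_ge0.
pose w := \sum_j z j *: v j.
have Nw : N w = N (v k).
  apply/eqP; rewrite eq_le; apply/andP; split.
    by apply: norm_le_sum => // [|j _]; [exact: norm_ge0|rewrite normZ].
  by have := ov.2 z k; rewrite zk Qp_abs1 mul1r.
pose v' i := if i == k then w else v i.
have Nv' i : N (v' i) = N (v i) by rewrite /v'; case: eqP => // ->.
suff Sv' : S v'.
  have := vmin v' Sv'; rewrite /f (bigD1 k) //= [leRHS](bigD1 k) //=.
  rewrite [X in _ <= _ + X](eq_bigr (fun i => N' (v i))) => [|i /negbTE ik].
    by rewrite lerD2r /v' eqxx leNgt zlt.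
  by rewrite /v' ik.
split; last by move=> i; rewrite Nv' Nv.
split=> [i|y i]; first by rewrite -(norm_gt0 normN) Nv' norm_gt0 //; exact: ov.1.
(* These are the coordinates in the old family of the combination of the new family with
   coefficients [y]. *)
pose y' j := if j == k then y k else y j + y k * z j.
have Ey : \sum_j y j *: v' j = \sum_j y' j *: v j.
  rewrite (bigD1 k) //= {1}/v' eqxx /w [in LHS](bigD1 k) //= zk scale1r.
  rewrite [RHS](bigD1 k) //= {1}/y' eqxx scalerDr -addrA; congr (_ + _).
  rewrite scaler_sumr -big_split /=; apply: eq_bigr => j /negbTE jk.
  by rewrite /v' /y' jk scalerA scalerDl addrC.
rewrite Nv' Ey; have hk := ov.2 y' k; rewrite {1}/y' eqxx in hk.
have [->//|ik] := eqVneq i k.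
have hi := ov.2 y' i; rewrite {1}/y' (negbTE ik) in hi.
(* Orthogonality of [v] controls [y' i] and [y k] only. The correction [y k * z i] is absorbed by
   the bound for index [k], because [abs (z i) * N (v i)] is at most [N (v k)]. *)
have -> : y i = (y i + y k * z i) - y k * z i by rewrite addrK.
have := Qp_absB R (y i + y k * z i) (y k * z i); rewrite le_max.
case/orP => h; first by apply: le_trans hi; rewrite ler_wpM2r // norm_ge0.
apply: le_trans hk; apply: le_trans (ler_wpM2r (norm_ge0 normN _) h) _.
by rewrite Qp_absM -mulrA ler_wpM2l ?Qp_abs_ge0.
Qed.

End CommonBasis.

(** * Common orthogonal bases *)

Section Bases.
Variables (R : realType) (p : nat) (hp : prime p) (V : vectType (Qp hp)).
Variable n : nat.
Hypothesis dimV : \dim {:V} = n.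
Local Notation abs := (@Qp_abs R p hp).

Lemma orthogonal_family_basis (N : V -> R) (v : 'I_n -> V) : is_norm N ->
  orthogonal_family N v -> basis_of {:V} [tuple v i | i < n].
Proof.
move=> normN ov; rewrite basisEfree subvf dimV size_tuple leqnn !andbT.
apply/freeP => c c0 i; apply: (orthogonal_family_free normN ov).
rewrite -{}[RHS]c0; apply: eq_bigr => j _.
by rewrite -tnth_nth tnth_mktuple.
Qed.

Lemma orthogonal_family_span (N : V -> R) (v : 'I_n -> V) : is_norm N ->
  orthogonal_family N v -> forall w, exists x, w = \sum_i x i *: v i.
Proof.
move=> normN ov w; have B := orthogonal_family_basis normN ov.
exists (fun i => coord [tuple v i | i < n] i w).
rewrite {1}(coord_basis B (memvf w)); apply: eq_bigr => i _.
by rewrite -tnth_nth tnth_mktuple.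
Qed.

Lemma orthogonal_family_orthogonal_basis (N : V -> R) (v : 'I_n -> V) :
  is_norm N -> orthogonal_family N v -> orthogonal_basis N [tuple v i | i < n].
Proof.
move=> normN ov; have B := orthogonal_family_basis normN ov.
have span_v : (\sum_(i < n) <[tnth [tuple v i | i < n] i]>)%VS = {:V}%VS.
  by rewrite -(span_basis B) span_def big_tuple.
split => //.
  apply/directvP; rewrite /= span_v dimV; under eq_bigr do
    rewrite dim_vline tnth_mktuple ov.1.
  by rewrite sum1_card card_ord.
move=> w hw; have /choice[x hx] i : exists x, w i = x *: v i.
  by have /vlineP[x ->] := hw i; exists x; rewrite tnth_mktuple.
rewrite (eq_bigr (fun i => x i *: v i)) => [|i _]; last exact: hx.
by rewrite norm_orthogonal_family //; apply: eq_bigr => i _; rewrite hx.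
Qed.

Section SupNorm.
Variable u : n.-tuple V.
Hypothesis basis_u : basis_of {:V} u.

Definition sup_norm (v : V) : R := \big[Num.max/0]_(i < n) abs (coord u i v).

Lemma sup_norm_is_norm : is_norm sup_norm.
Proof.
have ge0 v : 0 <= sup_norm v by exact: bigmax_ge_id.
split=> // [v|x v|v w].
- split=> [v0|->]; last first.
    apply/eqP; rewrite eq_le ge0 andbT; apply: bigmax_le => // i _.
    by rewrite linear0 Qp_abs0.
  rewrite (coord_basis basis_u (memvf v)) big1 // => i _.
  suff /eqP -> : coord u i v == 0 by rewrite scale0r.
  rewrite -(Qp_abs_eq0 R) eq_le Qp_abs_ge0 andbT -{}v0.
  exact: le_bigmax (fun i => abs (coord u i v)) i.
- rewrite /sup_norm; have := Qp_abs_ge0 R x.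
  move: (abs x) (fun y => Qp_absM R x y) => r rE r0.
  apply: (big_ind2 (fun a b => a = r * b)) => [|_ a _ b -> ->|i _].
  - by rewrite mulr0.
  - by rewrite maxr_pMr.
  by rewrite linearZ /= rE.
apply: bigmax_le => [|i _]; first by rewrite le_max ge0.
rewrite linearD /=; apply: le_trans (Qp_absD _ _ _) _; rewrite ge_max.
have leN t : abs (coord u i t) <= sup_norm t.
  exact: le_bigmax (fun i => abs (coord u i t)) i.
by rewrite !le_max !leN orbT.
Qed.

Lemma sup_norm_orthogonal : orthogonal_family sup_norm (tnth u).
Proof.
have Fu := basis_free basis_u.
split=> [i|x i].
  by rewrite (tnth_nth 0); apply: (free_not0 Fu); rewrite mem_nth // size_tuple.
rewrite [X in _ <= sup_norm X](eq_bigr (fun j => x j *: u`_j)) => [|j _]; last by rewrite (tnth_nth 0).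
apply: le_trans (_ : abs (x i) * 1 <= _).
  rewrite ler_wpM2l ?Qp_abs_ge0 //; apply: bigmax_le => // j _.
  by rewrite (tnth_nth 0) coord_free //; case: (_ == _); rewrite ?Qp_abs0 ?Qp_abs1.
rewrite mulr1 -{1}(coord_sum_free x i Fu).
exact: le_bigmax (fun i => abs (coord u i (\sum_j x j *: u`_j))) i.
Qed.

Lemma exists_common_orthogonal_family (N N' : V -> R) : is_norm N -> is_norm N' ->
  exists v : 'I_n -> V, orthogonal_family N v /\ orthogonal_family N' v.
Proof.
move=> normN normN'.
have [v [_ ov]] := exists_common_orthogonal sup_norm_is_norm normN
  sup_norm_orthogonal (orthogonal_family_span sup_norm_is_norm sup_norm_orthogonal).
exact: (exists_common_orthogonal normN normN' ov (orthogonal_family_span normN ov)).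
Qed.

End SupNorm.
End Bases.

(** Base [K] expansions let one counter run through all matrices, and another through all
    coefficient tuples, with entries below [K]. *)
Definition digit (K x i : nat) : nat := ((x %/ K ^ i) %% K)%N.

Lemma digit_surj (K m : nat) (d : nat -> nat) : (forall i, d i < K)%N ->
  exists2 x, (x < K ^ m)%N & forall i, (i < m)%N -> digit K x i = d i.
Proof.
elim: m d => [|m IH] d dK; first by exists 0%N.
have K0 : (0 < K)%N by exact: leq_ltn_trans (dK 0%N).
have [x xK hx] := IH (fun i => d i.+1) (fun i => dK i.+1).
exists (x * K + d 0%N)%N.
  rewrite expnSr; apply: leq_trans (_ : x.+1 * K <= _)%N; last by rewrite leq_mul2r xK orbT.
  by rewrite mulSn addnC ltn_add2r.
move=> [|i] im; rewrite /digit; first by rewrite expn0 divn1 modnMDl modn_small.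
by rewrite expnS divnMA divnMDl // (divn_small (dK 0%N)) addn0 -/(digit K x i) hx.
Qed.

(** * The finite test *)

Section Candidates.
Variables (R : realType) (p : nat) (hp : prime p) (V : vectType (Qp hp)).
Variables (n : nat) (u : n.-tuple V).
Local Notation abs := (@Qp_abs R p hp).

Definition candidate (K x i : nat) : V :=
  \sum_(j < n) (digit K x (i * n + j)%N)%:R *: tnth u j.

Definition combination (K x t : nat) : V :=
  \sum_(l < n) (digit K t l)%:R *: candidate K x l.

(** When [K] is a power of [p], the second condition makes the error of reducing coefficients modulo
    [K] negligible against every row; its case [i = j] excludes zero rows. The digit is compared
    with 1 inside the p-adic field because the machine makes the comparison there. *)
Definition passes (N : V -> R) (K x : nat) : Prop :=
  (forall t i, (t < K ^ n)%N -> (i < n)%N -> (digit K t i)%:R = 1 :> Qp hp ->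
     N (candidate K x i) <= N (combination K x t)) /\
  (forall i j, (i < n)%N -> (j < n)%N ->
     N (candidate K x i) < K%:R * N (candidate K x j)).

Lemma passes_orthogonal N e x : is_norm N -> (0 < e)%N -> passes N (p ^ e) x ->
  orthogonal_family N (fun i : 'I_n => candidate (p ^ e) x i).
Proof.
move=> normN e0 [ht hK]; set K := (p ^ e)%N in ht hK *.
set a := fun i : 'I_n => _.
have a0 i : a i != 0.
  apply/eqP => ai0; have := hK i i (ltn_ord i) (ltn_ord i).
  by rewrite -/(a i) ai0 norm0 // mulr0 ltxx.
split=> // y i0; rewrite leNgt; apply/negP => hy.
have [z [k [zk zg zle zlt]]] := orthogonal_family_defect normN (fun=> 1) hy.
have {}zg j : abs (z j) <= 1 by have := zg j ler01 ler01; rewrite mulr1.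
have K1 : (1 < K)%N by rewrite -(expn0 p) ltn_exp2l // prime_gt1.
(* The coefficient at [k] must be represented by exactly 1, since only then does the test compare
   row [k] with the combination. *)
have /choice[d hd] : forall j, exists dj : nat, [/\ (dj < K)%N,
    abs (z j - dj%:R) <= p%:R ^- e & j = k -> dj = 1%N].
  move=> j; have [->|jk] := eqVneq j k.
    by exists 1%N; rewrite zk subrr Qp_abs0 ltW // pXV_gt0.
  have [dj djK hdj] := @Qp_approx_nat R p hp (z j) e (zg j).
  by exists dj; split=> // /eqP; rewrite (negbTE jk).
pose d' i := if insub i is Some j then d j else 0%N.
have d'E (j : 'I_n) : d' j = d j by rewrite /d' valK.
have d'K i : (d' i < K)%N.
  by rewrite /d'; case: insub => [j|]; [case: (hd j)|exact: ltnW].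
have [t tK hdig] := digit_surj n d'K.
have digE (j : 'I_n) : digit K t j = d j by rewrite hdig.
have dk : d k = 1%N by case: (hd k) => _ _; exact.
have : N (a k) <= N (combination K x t).
  by apply: ht => //; rewrite digE dk.
apply/negP; rewrite -ltNge.
(* The tested combination is the short vector minus rounding errors of coefficient size at most
   [1 / K], each of which is shorter than row [k] by [hK]. *)
have -> : combination K x t =
    \sum_j z j *: a j - \sum_j (z j - (d j)%:R) *: a j.
  by rewrite -sumrB; apply: eq_bigr => j _; rewrite digE -scalerBl opprB addrC subrK.
apply: norm_ltD => //; rewrite normN1 //; apply: norm_lt_sum => [//||j _].
  by rewrite norm_gt0.
rewrite normZ //; case: (hd j) => _ hj _.
apply: le_lt_trans (ler_wpM2r (norm_ge0 normN _) hj) _.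
rewrite mulrC ltr_pdivrMr ?exprn_gt0 ?ltr0n ?prime_gt0 //.
by rewrite -natrX mulrC; exact: hK.
Qed.

Lemma orthogonal_passes N e x : is_norm N ->
  orthogonal_family N (fun i : 'I_n => candidate (p ^ e) x i) ->
  (forall i j : 'I_n, N (candidate (p ^ e) x i) < p%:R ^+ e * N (candidate (p ^ e) x j)) ->
  passes N (p ^ e) x.
Proof.
move=> normN [_ oa] hK; split=> [t i _ ilt d1|i j ilt jlt]; last first.
  by rewrite natrX; exact: (hK (Ordinal ilt) (Ordinal jlt)).
have := oa (fun j => (digit (p ^ e) t j)%:R) (Ordinal ilt).
by rewrite /= d1 Qp_abs1 mul1r.
Qed.

Lemma exists_passes N N' : \dim {:V} = n -> basis_of {:V} u -> is_norm N -> is_norm N' ->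
  exists e x, [/\ (0 < e)%N, (x < (p ^ e) ^ (n * n))%N,
    passes N (p ^ e) x & passes N' (p ^ e) x].
Proof.
move=> dimV basis_u normN normN'.
have [v0 [ov0 ov0']] := exists_common_orthogonal_family dimV basis_u normN normN'.
pose c0 (i j : 'I_n) := coord u j (v0 i).
(* A common power of [p] makes all coordinates integral, hence approximable by natural numbers;
   scaling preserves orthogonality. *)
have [k hk] : exists k, forall i j, abs (p%:R ^+ k * c0 i j) <= 1.
  have /choice[f hf] : forall q : 'I_n * 'I_n, exists k, forall l, (k <= l)%N ->
      abs (p%:R ^+ l * c0 q.1 q.2) <= 1 by move=> q; exact: Qp_abs_le1_scale.
  exists (\max_q f q)%N => i j; apply: (hf (i, j)); exact: leq_bigmax.
pose c i j := p%:R ^+ k * c0 i j.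
pose v i := \sum_j c i j *: tnth u j.
have vE i : v i = p%:R ^+ k *: v0 i.
  rewrite [v0 i in RHS](coord_basis basis_u (memvf (v0 i))) scaler_sumr.
  by apply: eq_bigr => j _; rewrite scalerA (tnth_nth 0).
have pk0 : p%:R ^+ k != 0 :> Qp hp by rewrite expf_neq0 // Qp_p_neq0.
have ov (M : V -> R) : is_norm M -> orthogonal_family M v0 -> orthogonal_family M v.
  move=> normM o0; have := orthogonal_familyZ normM (c := fun=> p%:R ^+ k) (fun=> pk0) o0.
  by rewrite (_ : (fun i => _) = v) //; apply/funext => i; rewrite vE.
have v_neq0 i : v i != 0 by exact: (ov _ normN ov0).1.
have [e1 he1] : exists e1, forall M, M = N \/ M = N' -> forall e, (e1 <= e)%N ->
    forall i (y : 'I_n -> Qp hp), (forall j, abs (y j - c i j) <= p%:R ^- e) ->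
    M (\sum_j y j *: tnth u j - v i) < M (v i).
  (* The Boolean selects one of the two norms, so that one maximum over a finite type gives a
     precision valid for both. *)
  have /choice[f hf] : forall q : 'I_n * bool, exists k, forall l (y : 'I_n -> Qp hp),
      (k <= l)%N -> (forall j, abs (y j - c q.1 j) <= p%:R ^- l) ->
      (if q.2 then N else N') (\sum_j y j *: tnth u j - v q.1) < (if q.2 then N else N') (v q.1).
    move=> [i b] /=.
    have [||k' hk'] := @norm_approx_lt R p hp V (if b then N else N') _ n (tnth u)
      ((if b then N else N') (v i)); first by case: b.
      by case: b; rewrite norm_gt0.
    by exists k' => l y kl hy; exact: hk' kl hy.
  exists (\max_q f q)%N => M hM e le_e i y hy.
  have le_f q : (f q <= e)%N by apply: leq_trans le_e; exact: leq_bigmax.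
  by case: hM => ->; [exact: (hf (i, true) e y)|exact: (hf (i, false) e y)].
have [e2 he2] : exists e2, forall M, M = N \/ M = N' -> forall e, (e2 <= e)%N ->
    forall i j, M (v i) < p%:R ^+ e * M (v j).
  have /choice[f hf] : forall q : 'I_n * 'I_n * bool, exists k, forall l, (k <= l)%N ->
      (if q.2 then N else N') (v q.1.1) < p%:R ^+ l * (if q.2 then N else N') (v q.1.2).
    move=> [[i j] b] /=; set M := if b then N else N'.
    have normM : is_norm M by rewrite /M; case: (b).
    have Mv i' : 0 < M (v i') by rewrite norm_gt0.
    have [k' hk'] := pXV_small hp (divr_gt0 (Mv j) (Mv i)); exists k' => l /hk'.
    by rewrite ltr_pdivlMr // ltr_pdivrMl // exprn_gt0 // ltr0n prime_gt0.
  exists (\max_q f q)%N => M hM e le_e i j.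
  have le_f q : (f q <= e)%N by apply: leq_trans le_e; exact: leq_bigmax.
  by case: hM => ->; [exact: (hf (i, j, true) e)|exact: (hf (i, j, false) e)].
pose e := (e1 + e2).+1; exists e.
have /choice[m hm] : forall q : 'I_n * 'I_n, exists mq : nat,
    (mq < p ^ e)%N /\ abs (c q.1 q.2 - mq%:R) <= p%:R ^- e.
  by move=> q; have [mq ? ?] := Qp_approx_nat e (hk q.1 q.2); exists mq.
(* Row-major layout of the approximating matrix [m], extended by 0 outside the matrix. *)
pose d i := if insub (i %/ n)%N is Some a then
  if insub (i %% n)%N is Some b then m (a, b) else 0%N else 0%N.
have dK i : (d i < p ^ e)%N.
  have p0 : (0 < p ^ e)%N by rewrite expn_gt0 prime_gt0.
  by rewrite /d; case: insub => [a|//]; case: insub => [b|//]; case: (hm (a, b)).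
have [x xlt hx] := digit_surj (n * n) dK.
exists x.
have digE (i j : 'I_n) : digit (p ^ e) x (i * n + j) = m (i, j).
  rewrite hx; last by have := ltn_ord i; have := ltn_ord j; nia.
  have n0 : (0 < n)%N by exact: leq_ltn_trans (ltn_ord i).
  by rewrite /d divnMDl // divn_small // addn0 valK modnMDl modn_small // valK.
have close M : M = N \/ M = N' -> forall i : 'I_n,
    M (candidate (p ^ e) x i - v i) < M (v i).
  move=> hM i; rewrite /candidate.
  apply: (he1 M hM e _ i (fun j : 'I_n => (digit (p ^ e) x (i * n + j))%:R)).
    by rewrite /e leqW // leq_addr.
  by move=> j; rewrite digE -(Qp_absN R) opprB; case: (hm (i, j)).
have pass M : M = N \/ M = N' -> is_norm M -> orthogonal_family M v -> passes M (p ^ e) x.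
  move=> hM normM oM; apply: orthogonal_passes => //.
    by apply: (orthogonal_family_perturb normM oM) => i; exact: close.
  move=> i j; rewrite !(norm_lt_eq normM (close M hM _)).
  by apply: (he2 M hM); rewrite /e leqW // leq_addl.
split => //; [apply: pass => //|apply: pass => //]; try by [left|right].
  exact: ov.
exact: ov.
Qed.

End Candidates.

(** * Total correctness of programs *)

Section TotalCorrectness.
Variables (R : realType) (p : nat) (hp : prime p) (V : vectType (Qp hp)).
Variables (n : nat) (u : n.-tuple V) (N N' : V -> R).
Implicit Types (s : state R hp) (c : program) (Q : state R hp -> Prop).

(** A weakest precondition for total correctness: the rules below verify a program by composing
    continuations [Q]. *)
Definition terminates c s Q := exists2 s', exec u N N' c s s' & Q s'.

Lemma terminatesW c s Q Q' : (forall s', Q s' -> Q' s') ->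
  terminates c s Q -> terminates c s Q'.
Proof. by move=> QQ' [s' h /QQ']; exists s'. Qed.

Lemma terminates_skip s Q : Q s -> terminates Skip s Q.
Proof. by exists s => //; exact: ExecSkip. Qed.

Lemma terminates_set_nat d e s Q : Q (set_nat s (eval_nat s d) (eval_nat s e)) ->
  terminates (SetNat d e) s Q.
Proof. by eexists; first exact: ExecSetNat. Qed.

Lemma terminates_set_Qp d e s Q : Q (set_Qp s (eval_nat s d) (eval_Qp s e)) ->
  terminates (SetQp d e) s Q.
Proof. by eexists; first exact: ExecSetQp. Qed.

Lemma terminates_call d e s Q :
  Q (set_real s (eval_nat s d) (N (stored_vector u s (eval_nat s e)))) ->
  terminates (CallN d e) s Q.
Proof. by eexists; first exact: ExecCallN. Qed.

Lemma terminates_call' d e s Q :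
  Q (set_real s (eval_nat s d) (N' (stored_vector u s (eval_nat s e)))) ->
  terminates (CallN' d e) s Q.
Proof. by eexists; first exact: ExecCallN'. Qed.

Lemma terminates_seq c1 c2 s Q :
  terminates c1 s (fun s' => terminates c2 s' Q) -> terminates (Seq c1 c2) s Q.
Proof. by case=> s1 h1 [s2 h2 Qs2]; exists s2 => //; exact: ExecSeq h1 h2. Qed.

Lemma terminates_if t c1 c2 s Q :
  (eval_test s t -> terminates c1 s Q) -> (~~ eval_test s t -> terminates c2 s Q) ->
  terminates (If t c1 c2) s Q.
Proof.
have [ht h _|ht _ h] := boolP (eval_test s t).
  by have [s' ? ?] := h isT; exists s' => //; exact: ExecIfTrue.
by have [s' ? ?] := h isT; exists s' => //; exact: ExecIfFalse.
Qed.

Lemma terminates_while (I : state R hp -> Prop) (mu : state R hp -> nat) t c s Q :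
  I s ->
  (forall s, I s -> eval_test s t -> terminates c s (fun s' => I s' /\ (mu s' < mu s)%N)) ->
  (forall s, I s -> ~~ eval_test s t -> Q s) ->
  terminates (While t c) s Q.
Proof.
move=> Is hc hQ; have [m] := ubnP (mu s); elim: m s Is => // m IH s Is mus.
have [ht|ht] := boolP (eval_test s t); last first.
  by exists s; [exact: ExecWhileStop|exact: hQ].
have [s1 h1 [Is1 mu1]] := hc s Is ht.
have [|s2 h2 Qs2] := IH s1 Is1; first exact: leq_trans mu1 _.
by exists s2 => //; exact: ExecWhileStep h1 h2.
Qed.

Definition load (a : nat) : nat_exp := NatLoad (NatConst a).

Definition for_loop (v : nat) (e : nat_exp) c : program :=
  Seq (SetNat (NatConst v) (NatConst 0))
    (While (Not (NatLe e (load v)))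
      (Seq c (SetNat (NatConst v) (NatAdd (load v) (NatConst 1))))).

(** The bound [e] is evaluated afresh at each turn, so the invariant must pin its value to [m]. As
    the invariant is restored only after the increment, it also forces the body to leave the counter
    intact. *)
Lemma terminates_for (I : nat -> state R hp -> Prop) (m v : nat) e c s Q :
  I 0%N (set_nat s v 0%N) ->
  (forall i s, I i s -> nat_mem s v = i /\ eval_nat s e = m) ->
  (forall i s, (i < m)%N -> I i s ->
    terminates c s (fun s' => I i.+1 (set_nat s' v (nat_mem s' v).+1))) ->
  (forall s, I m s -> Q s) ->
  terminates (for_loop v e c) s Q.
Proof.
move=> I0 Iv Ic IQ; apply: terminates_seq; apply: terminates_set_nat.
apply: (terminates_while (I := fun s => exists2 i, (i <= m)%N & I i s)
    (mu := fun s => (m - nat_mem s v)%N)); first by exists 0%N.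
- move=> s1 [i im Ii]; have [vi em] := Iv _ _ Ii.
  rewrite /eval_test em /eval_nat /= vi -ltnNge => lt_im.
  apply: terminates_seq; apply: terminatesW (Ic i s1 lt_im Ii) => s2 Ii2.
  have [vi2 _] := Iv _ _ Ii2.
  apply: terminates_set_nat; rewrite /eval_nat /= addn1; split; first by exists i.+1.
  by move: vi2; rewrite /= /update eqxx => ->; lia.
- move=> s1 [i im Ii]; have [vi em] := Iv _ _ Ii.
  rewrite /eval_test em /eval_nat /= vi negbK => le_mi.
  by apply: IQ; have -> : m = i by lia.
Qed.

End TotalCorrectness.

(** * The search program *)

(* Natural memory: 0 holds n, 1 holds p, 2 the digit base K, 3 the candidate x,
   4 whether the candidate passes, 5 the combination t, 6 and 7 indices, 8 the
   result of [power_prog], 10 to 12 scratch. p-adic memory, from the following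
   addresses on: 0 the candidate matrix, n * n the digits of t, n * n + n the
   coordinates of the combination. Real memory: the values of N and N' on the
   combination (0, 1), on row i (2, 3) and on row j (4, 5). *)
Definition dim2 : nat_exp := NatMul (load 0) (load 0).
Definition digits_at : nat_exp := dim2.
Definition combination_at : nat_exp := NatAdd dim2 (load 0).

Definition power_prog (len : nat_exp) : program :=
  Seq (SetNat (NatConst 8) (NatConst 1))
    (for_loop 10 len (SetNat (NatConst 8) (NatMul (load 8) (load 2)))).

(** The machine has no division: register 12 counts up to the quotient by the base, the remainder is
    emitted as a digit, and the quotient becomes the next dividend. *)
Definition digits_prog (src : nat) (len dest : nat_exp) : program :=
  Seq (SetNat (NatConst 10) (load src))
    (for_loop 11 len
      (Seq (SetNat (NatConst 12) (NatConst 0))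
      (Seq (While (NatLe (NatMul (NatAdd (load 12) (NatConst 1)) (load 2)) (load 10))
             (SetNat (NatConst 12) (NatAdd (load 12) (NatConst 1))))
      (Seq (SetQp (NatAdd dest (load 11))
             (FieldNat (NatSub (load 10) (NatMul (load 12) (load 2)))))
           (SetNat (NatConst 10) (load 12)))))).

Definition combination_prog : program :=
  let w := NatAdd combination_at (load 7) in
  for_loop 7 (load 0)
    (Seq (SetQp w (FieldNat (NatConst 0)))
      (for_loop 6 (load 0)
        (SetQp w (FieldAdd (FieldLoad w)
          (FieldMul (FieldLoad (NatAdd digits_at (load 6)))
            (FieldLoad (NatAdd (NatMul (load 6) (load 0)) (load 7)))))))).

Definition reject : program := SetNat (NatConst 4) (NatConst 0).

Definition real_load (a : nat) : field_exp := FieldLoad (NatConst a).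

Definition compare_rows_prog : program :=
  for_loop 7 (load 0)
    (Seq (CallN (NatConst 4) (NatMul (load 7) (load 0)))
    (Seq (CallN' (NatConst 5) (NatMul (load 7) (load 0)))
      (If (And (Not (RealLe (FieldMul (FieldNat (load 2)) (real_load 4)) (real_load 2)))
               (Not (RealLe (FieldMul (FieldNat (load 2)) (real_load 5)) (real_load 3))))
        Skip reject))).

Definition test_rows_prog : program :=
  for_loop 6 (load 0)
    (Seq (CallN (NatConst 2) (NatMul (load 6) (load 0)))
    (Seq (CallN' (NatConst 3) (NatMul (load 6) (load 0)))
    (Seq (If (And (QpEq (FieldLoad (NatAdd digits_at (load 6))) (FieldNat (NatConst 1)))
                  (Not (And (RealLe (real_load 2) (real_load 0))
                            (RealLe (real_load 3) (real_load 1)))))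
            reject Skip)
      compare_rows_prog))).

Definition test_prog : program :=
  for_loop 5 (load 8)
    (Seq (digits_prog 5 (load 0) digits_at)
    (Seq combination_prog
    (Seq (CallN (NatConst 0) combination_at)
    (Seq (CallN' (NatConst 1) combination_at)
      test_rows_prog)))).

Definition next_prog : program :=
  Seq (SetNat (NatConst 3) (NatAdd (load 3) (NatConst 1)))
  (Seq (power_prog dim2)
    (If (NatLe (load 8) (load 3))
      (Seq (SetNat (NatConst 3) (NatConst 0))
           (SetNat (NatConst 2) (NatMul (load 2) (load 1))))
      Skip)).

(** The counters advance even after a success. This is harmless, since the accepted matrix remains
    in p-adic memory from address 0 on, where the output is read. *)
Definition round_prog : program :=
  Seq (digits_prog 3 dim2 (NatConst 0))
  (Seq (SetNat (NatConst 4) (NatConst 1))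
  (Seq (power_prog (load 0))
  (Seq test_prog
       next_prog))).

(** The initial state has 0 at addresses 3 and 4, so the enumeration starts at [x = 0] and the loop
    is entered. *)
Definition search_prog : program :=
  Seq (SetNat (NatConst 2) (load 1))
    (While (NatLe (load 4) (NatConst 0)) round_prog).

Lemma forall_ltnS (P : nat -> Prop) i :
  (forall j, (j < i.+1)%N -> P j) <-> (forall j, (j < i)%N -> P j) /\ P i.
Proof.
split=> [h|[h Pi] j].
  by split=> [j ji|]; apply: h => //; exact: ltnW.
by rewrite ltnS leq_eqVlt => /orP[/eqP ->|/h].
Qed.

(** * The search *)

Section SearchCorrectness.
Variables (R : realType) (p : nat) (hp : prime p) (V : vectType (Qp hp)).
Variables (n : nat) (u : n.-tuple V) (N N' : V -> R).
Implicit Types (s : state R hp) (Q : state R hp -> Prop).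
Local Notation terminates := (terminates u N N').

Lemma power_progP (len : nat_exp) (K m : nat) s Q :
  nat_mem s 0 = n -> nat_mem s 2 = K ->
  (forall s', nat_mem s' 0 = n -> eval_nat s' len = m) ->
  (forall s', nat_mem s' 8 = (K ^ m)%N ->
    (forall a, (a < 8)%N -> nat_mem s' a = nat_mem s a) ->
    Qp_mem s' = Qp_mem s -> Q s') ->
  terminates (power_prog len) s Q.
Proof.
move=> s0 s2 hlen hQ; apply: terminates_seq; apply: terminates_set_nat.
apply: (terminates_for (m := m) (I := fun i s' => [/\ nat_mem s' 10 = i,
    nat_mem s' 8 = (K ^ i)%N, forall a, (a < 8)%N -> nat_mem s' a = nat_mem s a
  & Qp_mem s' = Qp_mem s])).
- by split => // -[|[|[|[|[|[|[|[|]]]]]]]].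
- by move=> i s1 [h10 _ hs _]; split=> //; apply: hlen; rewrite hs.
- move=> i s1 _ [h10 h8 hs hQp]; apply: terminates_set_nat.
  rewrite /eval_nat /=; split=> //=; rewrite /update /= ?h10 //.
    by rewrite h8 hs // s2 expnSr.
  by move=> [|[|[|[|[|[|[|[|]]]]]]]] //= _; exact: hs.
- by move=> s1 [_ h8 hs hQp]; exact: hQ.
Qed.

Lemma digits_progP (src : nat) (len dest : nat_exp) (K m d x : nat) s Q :
  (0 < K)%N -> (src < 10)%N -> nat_mem s src = x ->
  nat_mem s 0 = n -> nat_mem s 2 = K ->
  (forall s', nat_mem s' 0 = n -> eval_nat s' len = m) ->
  (forall s', nat_mem s' 0 = n -> eval_nat s' dest = d) ->
  (forall s', (forall a, (a < 10)%N -> nat_mem s' a = nat_mem s a) ->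
    (forall i, (i < m)%N -> Qp_mem s' (d + i)%N = (digit K x i)%:R) ->
    (forall a, (a < d)%N -> Qp_mem s' a = Qp_mem s a) -> Q s') ->
  terminates (digits_prog src len dest) s Q.
Proof.
move=> K0 src10 sx s0 s2 hlen hdest hQ.
apply: terminates_seq; apply: terminates_set_nat.
pose same s' := forall a, (a < 10)%N -> nat_mem s' a = nat_mem s a.
have same_set s' a k : (10 <= a)%N -> same s' -> same (set_nat s' a k).
  by move=> a10 h b b10; rewrite /= /update ltn_eqF ?h //; exact: leq_trans a10.
apply: (terminates_for (m := m) (I := fun i s' => [/\ nat_mem s' 11 = i,
    nat_mem s' 10 = (x %/ K ^ i)%N, same s',
    (forall i', (i' < i)%N -> Qp_mem s' (d + i')%N = (digit K x i')%:R)
  & (forall a, (a < d)%N -> Qp_mem s' a = Qp_mem s a)])).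
- split=> //; first by rewrite /= /update /= /eval_nat /= sx expn0 divn1.
  by do 2 apply: (same_set) => //.
- by move=> i s1 [h11 _ hs _ _]; split=> //; apply: hlen; rewrite hs.
- move=> i s1 _ [h11 h10 hs hd hlow].
  apply: terminates_seq; apply: terminates_set_nat; apply: terminates_seq.
  apply: (terminates_while (I := fun s' => [/\ (nat_mem s' 12 * K <= x %/ K ^ i)%N,
      nat_mem s' 11 = i, nat_mem s' 10 = (x %/ K ^ i)%N, same s' & Qp_mem s' = Qp_mem s1])
      (mu := fun s' => (x %/ K ^ i - nat_mem s' 12)%N)).
  + by split=> //; exact: same_set.
  + move=> s3 [h12 g11 g10 gs gQ].
    rewrite /= /eval_nat /= g10 (gs 2%N) // s2 addn1 => ht.
    apply: terminates_set_nat; rewrite /eval_nat /= /update /= addn1; split.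
      by split=> //; exact: (same_set _ 12%N).
    have : (nat_mem s3 12 < x %/ K ^ i)%N.
      by apply: leq_trans ht; rewrite leq_pmulr.
    by lia.
  + move=> s3 [h12 g11 g10 gs gQ].
    rewrite /= /eval_nat /= g10 (gs 2%N) // s2 addn1 -ltnNge => ht.
    (* The invariant and the failed guard enclose the dividend between two consecutive multiples of
       [K], so the counter is the exact quotient. *)
    have qE : nat_mem s3 12 = (x %/ K ^ i.+1)%N.
      rewrite expnSr divnMA; apply/eqP; rewrite eqn_leq leq_divRL // h12 /=.
      by rewrite -ltnS ltn_divLR.
    apply: terminates_seq; apply: terminates_set_Qp; apply: terminates_set_nat.
    rewrite [eval_nat s3 _]/= (_ : eval_nat s3 (NatAdd dest (load 11)) = (d + i)%N); last first.
      by rewrite -(hdest s3) ?gs // /eval_nat /= g11.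
    rewrite /eval_nat /eval_Qp /= g10 (gs 2%N) // s2.
    split=> //=.
    * by rewrite /update /= g11.
    * by apply: (same_set _ 11%N) => //; exact: (same_set (set_Qp s3 _ _) 10%N).
    * move=> i' ii'; rewrite /update eqn_add2l.
      have [->|ne] := eqVneq i' i; last by rewrite gQ hd // ltn_neqAle ne.
      by rewrite /digit qE expnSr divnMA {1}(divn_eq (x %/ K ^ i) K) addKn.
    * by move=> a ad; rewrite /update ltn_eqF ?gQ ?hlow // ltn_addr.
- by move=> s1 [_ _ hs hd hlow]; exact: hQ.
Qed.

Definition stores (K x : nat) s : Prop :=
  forall a, (a < n * n)%N -> Qp_mem s a = (digit K x a)%:R.

Definition ready (K x : nat) s : Prop :=
  [/\ nat_mem s 0 = n, nat_mem s 1 = p, nat_mem s 2 = K, nat_mem s 3 = x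
    & stores K x s].

Definition accepting s : bool := (0 < nat_mem s 4)%N.

Lemma ready_same K x s s' : ready K x s ->
  (forall a, (a < 4)%N -> nat_mem s' a = nat_mem s a) ->
  (forall a, (a < n * n)%N -> Qp_mem s' a = Qp_mem s a) -> ready K x s'.
Proof.
case=> s0 s1 s2 s3 sQ hn hQ; split; rewrite ?hn // => a an.
by rewrite hQ // sQ.
Qed.

Lemma stored_candidate K x s i : stores K x s -> (i < n)%N ->
  stored_vector u s (i * n) = candidate u K x i.
Proof.
move=> sQ ilt; apply: eq_bigr => j _; rewrite sQ //.
by have := ltn_ord j; nia.
Qed.

(** * Verification of the finite test *)

Section Test.
Variables (K x : nat).
Local Notation cand := (candidate u K x).
Local Notation comb := (combination u K x).

Lemma combination_progP t s Q : ready K x s ->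
  (forall l, (l < n)%N -> Qp_mem s (n * n + l)%N = (digit K t l)%:R) ->
  (forall s', (forall a, (a < 6)%N -> nat_mem s' a = nat_mem s a) ->
    nat_mem s' 8 = nat_mem s 8 ->
    (forall a, (a < n * n + n)%N -> Qp_mem s' a = Qp_mem s a) ->
    stored_vector u s' (n * n + n) = comb t -> Q s') ->
  terminates combination_prog s Q.
Proof.
move=> [s0 _ _ _ sQ] st hQ.
pose term l j : Qp hp := (digit K t l)%:R * (digit K x (l * n + j)%N)%:R.
pose same s' := (forall a, (a < 6)%N -> nat_mem s' a = nat_mem s a) /\
  nat_mem s' 8 = nat_mem s 8.
have same0 s' : same s' -> nat_mem s' 0 = n by case=> h _; rewrite h.
have same_set s' a k : (a == 6) || (a == 7) -> same s' -> same (set_nat s' a k).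
  by case/orP => /eqP -> [h h8]; split=> //= -[|[|[|[|[|[|]]]]]] //= bl; exact: h.
apply: (terminates_for (m := n) (I := fun j s' => [/\ nat_mem s' 7 = j, same s',
    (forall a, (a < n * n + n)%N -> Qp_mem s' a = Qp_mem s a)
  & (forall j', (j' < j)%N -> Qp_mem s' (n * n + n + j')%N = \sum_(l < n) term l j')])).
- by split=> //; exact: same_set.
- by move=> j s1 [h7 hs _ _]; split=> //; exact: same0.
- move=> j s1 jn [h7 hs hlow hw]; apply: terminates_seq; apply: terminates_set_Qp.
  rewrite /eval_nat /eval_Qp /= h7 (same0 _ hs).
  apply: (terminates_for (m := n) (I := fun i s' => [/\ nat_mem s' 6 = i,
      nat_mem s' 7 = j /\ same s',
      (forall a, (a < n * n + n)%N -> Qp_mem s' a = Qp_mem s a),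
      (forall j', (j' < j)%N -> Qp_mem s' (n * n + n + j')%N = \sum_(l < n) term l j')
    & Qp_mem s' (n * n + n + j)%N = \sum_(0 <= l < i) term l j])).
  + split=> //=.
    * by split; [|exact: (same_set (set_Qp s1 _ _))].
    * by move=> a an; rewrite /update ltn_eqF ?hlow // ltn_addr.
    * by move=> j' jj'; rewrite /update eqn_add2l ltn_eqF // hw.
    * by rewrite /update eqxx big_nil.
  + by move=> i s2 [h6 [_ hs2] _ _ _]; split=> //; exact: same0.
  + move=> i s2 ilt [h6 [g7 hs2] hlow2 hw2 hwj]; apply: terminates_set_Qp.
    rewrite /eval_nat /eval_Qp /= g7 h6 (same0 _ hs2); split=> //=.
    * by split; [|exact: (same_set (set_Qp s2 _ _))].
    * by move=> a an; rewrite /update ltn_eqF ?hlow2 // ltn_addr.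
    * by move=> j' jj'; rewrite /update eqn_add2l ltn_eqF // hw2.
    * rewrite /update eqxx hwj big_nat_recr //= hlow2 ?ltn_add2l //.
      rewrite hlow2; last by nia.
      by rewrite st // sQ //; nia.
  + move=> s2 [_ [g7 hs2] hlow2 hw2 hwj]; split=> //=.
    * by rewrite /update /= g7.
    * exact: same_set.
    * by apply/forall_ltnS; split=> //; rewrite hwj big_mkord.
- move=> s1 [_ [hs hs8] hlow hw]; apply: hQ => //.
  (* The machine works coordinate by coordinate while [combination] sums over rows; exchanging the
     two sums reconciles them. *)
  rewrite /stored_vector /combination (eq_bigr (fun j : 'I_n =>
      \sum_(l < n) term l j *: tnth u j)) => [|j _]; last by rewrite hw // scaler_suml.
  rewrite exchange_big; apply: eq_bigr => l _.
  by rewrite scaler_sumr; apply: eq_bigr => j _; rewrite scalerA.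
Qed.

Definition row_gap (i j : nat) : Prop :=
  N (cand i) < K%:R * N (cand j) /\ N' (cand i) < K%:R * N' (cand j).

(** This is what one pass over row [i] checks for both norms at once; the gap conditions,
    independent of [t], are checked again for every [t]. *)
Definition row_ok (t i : nat) : Prop :=
  ((digit K t i)%:R = 1 :> Qp hp -> N (cand i) <= N (comb t) /\ N' (cand i) <= N' (comb t)) /\
  forall j, (j < n)%N -> row_gap i j.

(** [C] is the verdict accumulated before this loop. Inside the loop the flag can only be lowered,
    so the new verdict is [C] in conjunction with the gaps just checked. *)
Lemma compare_rows_progP (C : Prop) i s Q : ready K x s ->
  real_mem s 2 = N (cand i) -> real_mem s 3 = N' (cand i) -> (accepting s <-> C) ->
  (forall s', (forall a, (a != 4)%N -> (a != 7)%N -> nat_mem s' a = nat_mem s a) ->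
    Qp_mem s' = Qp_mem s -> (forall a, (a < 2)%N -> real_mem s' a = real_mem s a) ->
    (accepting s' <-> C /\ forall j, (j < n)%N -> row_gap i j) -> Q s') ->
  terminates compare_rows_prog s Q.
Proof.
move=> rs r2 r3 aC hQ.
pose same s' := [/\ (forall a, (a != 4)%N -> (a != 7)%N -> nat_mem s' a = nat_mem s a),
  Qp_mem s' = Qp_mem s & (forall a, (a < 4)%N -> real_mem s' a = real_mem s a)].
have same_ready s' : same s' -> ready K x s'.
  case=> hn hq _; apply: ready_same rs _ _ => [a a4|a _]; last by rewrite hq.
  by apply: hn; lia.
apply: (terminates_for (m := n) (I := fun j s' => [/\ nat_mem s' 7 = j, same s'
  & (accepting s' <-> C /\ forall j', (j' < j)%N -> row_gap i j')])).
- split=> //; first by split=> // a a4 a7; rewrite /= /update (negbTE a7).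
  by rewrite /accepting /=; split=> [/aC|[/aC]].
- by move=> j s1 [h7 /same_ready[s0 _ _ _ _] _].
- move=> j s1 jn [h7 hs ha]; have [s0 _ s2 _ sQ] := same_ready _ hs.
  case: hs => hn hq hr.
  apply: terminates_seq; apply: terminates_call; apply: terminates_seq.
  apply: terminates_call'.
  rewrite /eval_nat /= h7 s0 /stored_vector /= -!/(stored_vector _ _ _).
  rewrite !(stored_candidate sQ jn).
  apply: terminates_if.
    rewrite /= /eval_real /= /update /= !hr // r2 r3 s2 -!ltNge => /andP[lt1 lt2].
    apply: terminates_skip; rewrite /= h7; split=> //.
      split=> //= [a a4 a7|a a4]; rewrite /update; first by rewrite (negbTE a7) hn.
      by rewrite !ltn_eqF ?hr //; lia.
    rewrite /accepting /= forall_ltnS; split=> [/ha[c h]|[c [h _]]] //.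
    by apply/ha.
  rewrite /= /eval_real /= /update /= !hr // r2 r3 s2 -!ltNge => no.
  apply: terminates_set_nat; rewrite /= /update /= h7; split=> //.
    split=> //= [a a4 a7|a a4]; rewrite /update; first by rewrite (negbTE a7) (negbTE a4) hn.
    by rewrite !ltn_eqF ?hr //; lia.
  rewrite /accepting /= forall_ltnS; split=> [//|[_ [_ [lt1 lt2]]]].
  by move: no; rewrite lt1 lt2.
- move=> s1 [_ [hn hq hr] ha]; apply: hQ => // a a2; apply: hr; lia.
Qed.

Lemma test_rows_progP (C : Prop) t s Q : ready K x s ->
  (forall l, (l < n)%N -> Qp_mem s (n * n + l)%N = (digit K t l)%:R) ->
  real_mem s 0 = N (comb t) -> real_mem s 1 = N' (comb t) -> (accepting s <-> C) ->
  (forall s', (forall a, (a != 4)%N -> (a != 6)%N -> (a != 7)%N -> nat_mem s' a = nat_mem s a) ->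
    Qp_mem s' = Qp_mem s ->
    (accepting s' <-> C /\ forall i, (i < n)%N -> row_ok t i) -> Q s') ->
  terminates test_rows_prog s Q.
Proof.
move=> rs st r0 r1 aC hQ.
pose same s' := [/\ (forall a, (a != 4)%N -> (a != 6)%N -> (a != 7)%N -> nat_mem s' a = nat_mem s a),
  Qp_mem s' = Qp_mem s & (forall a, (a < 2)%N -> real_mem s' a = real_mem s a)].
have same_ready s' : same s' -> ready K x s'.
  case=> hn hq _; apply: ready_same rs _ _ => [a a4|a _]; last by rewrite hq.
  by apply: hn; lia.
apply: (terminates_for (m := n) (I := fun i s' => [/\ nat_mem s' 6 = i, same s'
  & (accepting s' <-> C /\ forall i', (i' < i)%N -> row_ok t i')])).
- split=> //; first by split=> // a a4 a6 a7; rewrite /= /update (negbTE a6).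
  by rewrite /accepting /=; split=> [/aC|[/aC]].
- by move=> i s1 [h6 /same_ready[s0 _ _ _ _] _].
- move=> i s1 ilt [h6 hs ha]; have rs1 := same_ready _ hs.
  have [s0 _ s2 _ sQ] := rs1; case: hs => hn hq hr.
  apply: terminates_seq; apply: terminates_call; apply: terminates_seq.
  apply: terminates_call'; apply: terminates_seq.
  rewrite /eval_nat /= h6 s0 /stored_vector /= -!/(stored_vector _ _ _).
  rewrite !(stored_candidate sQ ilt).
  set s3 := set_real _ _ _.
  pose D : Prop := (digit K t i)%:R = 1 :> Qp hp ->
    N (cand i) <= N (comb t) /\ N' (cand i) <= N' (comb t).
  (* Both branches of the conditional continue with the same inner loop; only the reason why the
     flag reflects [D] differs. *)
  have rest s4 : ready K x s4 ->
      (forall a, (a != 4)%N -> (a != 6)%N -> (a != 7)%N -> nat_mem s4 a = nat_mem s a) ->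
      nat_mem s4 6 = i -> Qp_mem s4 = Qp_mem s -> real_mem s4 = real_mem s3 ->
      (accepting s4 <-> (C /\ forall i', (i' < i)%N -> row_ok t i') /\ D) ->
      terminates compare_rows_prog s4 (fun s' => [/\ nat_mem (set_nat s' 6 (nat_mem s' 6).+1) 6 = i.+1,
        same (set_nat s' 6 (nat_mem s' 6).+1)
        & (accepting (set_nat s' 6 (nat_mem s' 6).+1) <->
           C /\ forall i', (i' < i.+1)%N -> row_ok t i')]).
    move=> rs4 gn g6 gq gr ga; apply: (compare_rows_progP (i := i) rs4 _ _ ga).
    - by rewrite gr.
    - by rewrite gr.
    move=> s5 kn kq kr ka; split=> /=.
    - by rewrite /update /= kn // g6.
    - split=> //= [a a4 a6 a7||a a2].
      + by rewrite /update (negbTE a6) kn // gn.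
      + by rewrite kq.
      + by rewrite kr // gr /= /update !ltn_eqF ?hr //; lia.
    rewrite {1}/accepting /= -/(accepting s5) forall_ltnS ka.
    by rewrite /row_ok -/D; split=> [[[[c h] d] g]|[c [h [d g]]]].
  apply: terminates_if.
    rewrite /= /eval_real /eval_Qp /eval_nat /= /update /= h6 s0 hq st // !hr //.
    rewrite r0 r1 => /andP[/eqP d1 /negP no].
    apply: terminates_set_nat; apply: rest => //.
    - by move=> a a4 a6 a7; rewrite /= /update /= (negbTE a4) hn.
    - rewrite /accepting /=; split=> [//|[_ /(_ d1)[l1 l2]]].
      by case: no; rewrite l1 l2.
  rewrite /= /eval_real /eval_Qp /eval_nat /= /update /= h6 s0 hq st // !hr //.
  rewrite r0 r1 => no; apply: terminates_skip; apply: rest => //.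
  rewrite ha; split=> [h|[//]]; split=> // d1.
  by move: no; rewrite d1 eqxx /= negbK => /andP.
- by move=> s1 [_ [hn hq _] ha]; exact: hQ.
Qed.

Lemma test_progP s Q : (0 < K)%N -> ready K x s -> nat_mem s 8 = (K ^ n)%N ->
  accepting s ->
  (forall s', ready K x s' ->
    (accepting s' <-> forall t, (t < K ^ n)%N -> forall i, (i < n)%N -> row_ok t i) ->
    Q s') ->
  terminates test_prog s Q.
Proof.
move=> K0 rs s8 acc hQ.
apply: (terminates_for (m := (K ^ n)%N) (I := fun t s' => [/\ nat_mem s' 5 = t,
    ready K x s', nat_mem s' 8 = (K ^ n)%N
  & (accepting s' <-> forall t', (t' < t)%N -> forall i, (i < n)%N -> row_ok t' i)])).
- by [].
- by move=> t s1 [h5 _ h8 _].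
- move=> t s1 tlt [h5 rs1 h8 ha]; have [s0 _ s2 _ sQ] := rs1.
  apply: terminates_seq; apply: (digits_progP (m := n) (d := (n * n)%N) K0 _ h5 s0 s2) => //.
  + by move=> s' s0'; rewrite /eval_nat /= s0'.
  move=> s3 hn3 hd3 hlow3.
  have rs3 : ready K x s3.
    by apply: ready_same rs1 _ _ => // a a4; apply: hn3; lia.
  apply: terminates_seq; apply: (combination_progP rs3 hd3) => s4 hn4 h84 hlow4 hw4.
  have rs4 : ready K x s4.
    apply: ready_same rs3 _ _ => a alt; [apply: hn4|apply: hlow4]; lia.
  have [s40 _ _ _ _] := rs4.
  apply: terminates_seq; apply: terminates_call; apply: terminates_seq.
  apply: terminates_call'.
  rewrite /eval_nat /= s40 /stored_vector /= -!/(stored_vector _ _ _) !hw4.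
  apply: (test_rows_progP (t := t) (C := forall t', (t' < t)%N ->
      forall i, (i < n)%N -> row_ok t' i)) => //.
  + by move=> l ln; rewrite /= hlow4 ?hd3 // ltn_add2l.
  + by rewrite /accepting /= hn4 // hn3.
  move=> s5 hn5 hQ5 ha5; split=> /=.
  + by rewrite /update /= hn5 //= hn4 // hn3 // h5.
  + apply: ready_same rs4 _ _ => /= a alt; last by rewrite hQ5.
    by move: a alt => -[|[|[|[|]]]] //= _; rewrite /update /= hn5.
  + by rewrite /update /= hn5 //= h84 hn3.
  + by rewrite /accepting /= -/(accepting s5) ha5 forall_ltnS.
- by move=> s1 [_ rs1 _ ha]; exact: hQ.
Qed.

End Test.

(** An abstract model of the counters: reaching a good pair becomes a statement about iterating this
    function, free of machine states. *)
Definition next_candidate (q : nat * nat) : nat * nat :=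
  if (q.1 ^ (n * n) <= q.2.+1)%N then ((q.1 * p)%N, 0%N) else (q.1, q.2.+1).

Definition searching (q : nat * nat) s : Prop :=
  [/\ nat_mem s 0 = n, nat_mem s 1 = p, nat_mem s 2 = q.1 & nat_mem s 3 = q.2].

Definition found (q : nat * nat) : Prop := passes u N q.1 q.2 /\ passes u N' q.1 q.2.

Lemma round_progP q s Q : (0 < n)%N -> (0 < q.1)%N -> searching q s ->
  (forall s', searching (next_candidate q) s' -> stores q.1 q.2 s' ->
    (accepting s' <-> found q) -> Q s') ->
  terminates round_prog s Q.
Proof.
case: q => K x /= n0 K0 [s0 s1 s2 s3] hQ.
apply: terminates_seq.
apply: (digits_progP (m := (n * n)%N) (d := 0%N) K0 _ s3 s0 s2) => //.
  by move=> s' s0'; rewrite /eval_nat /= s0'.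
move=> s4 hn4 hd4 _; have rs4 : ready K x s4.
  by split; rewrite ?hn4 // => a /hd4; rewrite add0n.
apply: terminates_seq; apply: terminates_set_nat; apply: terminates_seq.
have [s40 _ s42 _ _] := rs4.
apply: (power_progP (K := K) (m := n)) => //= s5 h85 hn5 hQ5.
apply: terminates_seq; apply: (test_progP K0 _ h85).
- apply: ready_same rs4 _ _ => a alt; last by rewrite hQ5.
  by move: a alt => -[|[|[|[|]]]] // _; rewrite hn5.
- by rewrite /accepting hn5.
move=> s6 rs6 ha6; have [s60 s61 s62 s63 sQ6] := rs6.
have {}ha6 : accepting s6 <-> found (K, x).
  rewrite ha6; split=> [h|[[h1 h2] [h1' h2']] t tlt i ilt]; last first.
    split=> [d1|j jlt]; first by split; [exact: h1|exact: h1'].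
    by split; [exact: h2|exact: h2'].
  (* The gap conditions are read off from the combination numbered 0, which always exists. *)
  have T0 : (0 < K ^ n)%N by rewrite expn_gt0 K0.
  split; split=> [t i tlt ilt d1|i j ilt jlt].
  - by have [/(_ d1)[]] := h t tlt i ilt.
  - by have [_ /(_ j jlt)[]] := h 0%N T0 i ilt.
  - by have [/(_ d1)[]] := h t tlt i ilt.
  - by have [_ /(_ j jlt)[]] := h 0%N T0 i ilt.
apply: terminates_seq; apply: terminates_set_nat; rewrite /eval_nat /= s63 addn1.
apply: terminates_seq; apply: (power_progP (K := K) (m := (n * n)%N)) => //.
  by move=> s' s0'; rewrite /eval_nat /= s0'.
move=> s7 h87 hn7 hQ7.
have sQ7 : stores K x s7 by rewrite /stores hQ7.
apply: terminates_if; rewrite /= /eval_nat /= h87 hn7 //= /update /= => hle.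
  apply: terminates_seq; do 2 apply: terminates_set_nat.
  rewrite /eval_nat /=; apply: hQ => //.
    rewrite /next_candidate /= hle; split=> //=; rewrite /update /= hn7 //=.
    by rewrite hn7 //= /update /= s61 s62.
  by rewrite /accepting /= /update /= hn7.
apply: terminates_skip; apply: hQ => //.
  by rewrite /next_candidate /= (negbTE hle); split; rewrite hn7.
by rewrite /accepting hn7.
Qed.

(** [m] only bounds the number of remaining rounds and is unknown to the program. The loop may stop
    at an earlier success, hence the existential [k]. *)
Lemma search_loopP m q s : (0 < n)%N -> (0 < p)%N -> (0 < q.1)%N ->
  found (iter m next_candidate q) -> searching q s -> ~~ accepting s ->
  terminates (While (NatLe (load 4) (NatConst 0)) round_prog) s (fun s' =>
    exists2 k, found (iter k next_candidate q) & stores (iter k next_candidate q).1 (iter k next_candidate q).2 s').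
Proof.
move=> n0 p0; elim: m q s => [|m IH] q s q0 fm ss acc;
  have [s1 e1 [ss1 sQ1 fs1]] : terminates round_prog s (fun s' =>
    [/\ searching (next_candidate q) s', stores q.1 q.2 s' & (accepting s' <-> found q)])
    by apply: (round_progP n0 q0 ss).
- exists s1; last by exists 0%N.
  apply: ExecWhileStep e1 _; first by rewrite /= /eval_nat /= leqNgt.
  by apply: ExecWhileStop; rewrite /= /eval_nat /= -ltnNge; exact/fs1.
have [a1|a1] := boolP (accepting s1).
  exists s1; last by exists 0%N; first exact/fs1.
  apply: ExecWhileStep e1 _; first by rewrite /= /eval_nat /= leqNgt.
  by apply: ExecWhileStop; rewrite /= /eval_nat /= -ltnNge.
have [||s2 e2 [k fk sQ2]] := IH (next_candidate q) s1 _ _ ss1 a1.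
- by rewrite /next_candidate; case: ifP => //= _; rewrite muln_gt0 q0.
- by rewrite -iterSr.
exists s2; last by exists k.+1; rewrite iterSr.
by apply: ExecWhileStep e1 e2; rewrite /= /eval_nat /= leqNgt.
Qed.

Lemma iter_next_row K x : (x < K ^ (n * n))%N -> iter x next_candidate (K, 0%N) = (K, x).
Proof.
elim: x => // x IH ltx; rewrite iterS IH; last exact: ltnW.
by rewrite /next_candidate /= leqNgt ltx.
Qed.

Lemma iter_next_reach e x : (0 < p)%N -> (0 < e)%N -> (x < (p ^ e) ^ (n * n))%N ->
  exists m, iter m next_candidate (p, 0%N) = ((p ^ e)%N, x).
Proof.
move=> p0 e0 ltx; suff [m hm] : exists m, iter m next_candidate (p, 0%N) = ((p ^ e)%N, 0%N).
  by exists (x + m)%N; rewrite iterD hm iter_next_row.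
case: e e0 {ltx} => // e _; elim: e => [|e [m hm]]; first by exists 0%N.
pose y := ((p ^ e.+1) ^ (n * n))%N.
have y0 : (0 < y)%N by rewrite !expn_gt0 p0.
(* [y.-1] steps lead to the last matrix in base [p ^ e.+1], and one more step raises the base. *)
exists (y.-1.+1 + m)%N; rewrite iterD hm iterS iter_next_row; last by rewrite prednK.
by rewrite /next_candidate /= prednK // leqnn -expnSr.
Qed.

(** The search may stop at another pair than the one whose existence was proved. Soundness still
    applies there, because every base visited is a positive power of [p]. *)
Lemma iter_next_pow m : exists2 e, (0 < e)%N & (iter m next_candidate (p, 0%N)).1 = (p ^ e)%N.
Proof.
elim: m => [|m [e e0 he]]; first by exists 1%N; rewrite ?expn1.
rewrite iterS /next_candidate; case: ifP => _; last by exists e.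
by exists e.+1 => //=; rewrite he expnSr.
Qed.

End SearchCorrectness.

Theorem theorem4p3 (R : realType) :
  exists c : program,
  forall (p : nat) (hp : prime p) (n : nat) (V : vectType (Qp hp))
    (N N' : V -> R) (u : n.-tuple V),
    (0 < n)%N -> \dim {:V} = n -> is_norm N -> is_norm N' ->
    basis_of {:V} u ->
    exists2 s : state R hp,
      exec u N N' c (initial_state R hp n) s
    & orthogonal_basis N (output_basis u s) /\
      orthogonal_basis N' (output_basis u s).
Proof.
exists search_prog => p hp n V N N' u n0 dimV normN normN' basis_u.
have p0 : (0 < p)%N by exact: prime_gt0.
have [e [x [e0 xlt ps ps']]] := exists_passes dimV basis_u normN normN'.
have [m hm] := iter_next_reach p0 e0 xlt.
suff [s es [k [fk fk'] sk]] : terminates u N N' search_prog (initial_state R hp n)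
    (fun s => exists2 k, found u N N' (iter k (next_candidate p n) (p, 0%N))
      & stores n (iter k (next_candidate p n) (p, 0%N)).1 (iter k (next_candidate p n) (p, 0%N)).2 s).
  exists s => //; have [e' e'0 hK] := iter_next_pow p n k.
  move: fk fk' sk; rewrite hK => fk fk' sk.
  have -> : output_basis u s = [tuple candidate u (p ^ e') (iter k (next_candidate p n) (p, 0%N)).2 i | i < n].
    by apply: eq_from_tnth => i; rewrite !tnth_mktuple (stored_candidate u sk).
  by split; apply: orthogonal_family_orthogonal_basis => //; exact: passes_orthogonal.
apply: terminates_seq; apply: terminates_set_nat.
by apply: (search_loopP (m := m) n0 p0) => //; rewrite hm.
Qed.
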